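(* Under the assumptions below, the HJBQVI satisfies a comparison principle: if $U,V:[0,T]\times\mathbb R\to\mathbb R$ are bounded, $U$ is a viscosity subsolution and $V$ a viscosity supersolution of the HJBQVI, then $U\le V$ on $[0,T]\times\mathbb R$.
   Context: Fix $T>0$, a nonempty compact metric space $W$, a metric space $Y$, and for each $(t,x)\in[0,T]\times\mathbb R$ a nonempty compact set $Z(t,x)\subseteq Y$ such that $(t,x)\mapsto Z(t,x)$ is continuous with respect to the Hausdorff metric. Let $a,b:\mathbb R\times W\to\mathbb R$ (independent of time), $f:[0,T]\times\mathbb R\times W\to\mathbb R$, $g:\mathbb R\to\mathbb R$, $\Gamma(t,x,z)\in\mathbb R$, $K(t,x,z)\in\mathbb R$ be continuous, with $f,g$ bounded, $\sup_{t,x,z}K(t,x,z)<0$, and $|a(x,w)-a(y,w)|+|b(x,w)-b(y,w)|\le C|x-y|$ for all $x,y,w$ with $C$ independent of $w$. Intervention operator: $\mathcal MV(t,x)=\sup_{z\in Z(t,x)}\{V(t,\Gamma(t,x,z))+K(t,x,z)\}$, and $\mathcal Mg(x)=\sup_{z\in Z(T,x)}\{g(\Gamma(T,x,z))+K(T,x,z)\}$; assume $\mathcal Mg\le g$ pointwise. Let $\Omega=[0,T)\times\mathbb R$ and define $F((t,x),r,(q,p),A,\ell)=\min\{-q-\sup_{w\in W}\{\tfrac12b(x,w)^2A+a(x,w)p+f(t,x,w)\},\,r-\ell\}$ if $t<T$ and $=\min\{r-g(x),r-\ell\}$ if $t=T$. An upper (resp. lower) semicontinuous $V$ on $[0,T]\times\mathbb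 R$ is a viscosity subsolution (resp. supersolution) of the HJBQVI if for every $\varphi\in C^{1,2}$ (on a neighbourhood of $[0,T]\times\mathbb R$) and every $(t,x)\in[0,T]\times\mathbb R$ at which $V-\varphi$ has a local maximum (resp. minimum), $F_*((t,x),V(t,x),(\varphi_t,\varphi_x)(t,x),\varphi_{xx}(t,x),\mathcal MV(t,x))\le0$ (resp. $F^*(\ldots)\ge0$), where $F_*,F^*$ are the lower/upper semicontinuous envelopes of $F$. *)

(* Defs.v *)
From Stdlib Require Import Reals Lra ClassicalEpsilon.
Open Scope R_scope.

(** Supremum of a set of reals (value when the least upper bound exists;
    an arbitrary value 0 otherwise -- only used on nonempty bounded sets). *)
Definition Rsup (E : R -> Prop) : R :=
  match excluded_middle_informative (exists l, is_lub E l) with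
  | left H => proj1_sig (constructive_indefinite_description _ H)
  | right _ => 0
  end.

Definition Rinf (E : R -> Prop) : R := - Rsup (fun v => E (- v)).

Definition is_metric {X : Type} (d : X -> X -> R) : Prop :=
  (forall x y, 0 <= d x y) /\ (forall x y, d x y = 0 <-> x = y) /\
  (forall x y, d x y = d y x) /\ (forall x y z, d x z <= d x y + d y z).

Definition seq_cv {X : Type} (d : X -> X -> R) (u : nat -> X) (l : X) : Prop :=
  forall eps, 0 < eps -> exists N : nat, forall n, (N <= n)%nat -> d (u n) l < eps.

Definition compact_set {X : Type} (d : X -> X -> R) (A : X -> Prop) : Prop :=
  forall u : nat -> X, (forall n, A (u n)) ->
  exists (phi : nat -> nat) (l : X),
    (forall n, (phi n < phi (S n))%nat) /\ A l /\ seq_cv d (fun n => u (phi n)) l.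

Definition dist_to_set {X : Type} (d : X -> X -> R) (x : X) (B : X -> Prop) : R :=
  Rinf (fun v => exists y, B y /\ v = d x y).

Definition hausdorff_dist {X : Type} (d : X -> X -> R) (A B : X -> Prop) : R :=
  Rmax (Rsup (fun v => exists x, A x /\ v = dist_to_set d x B))
       (Rsup (fun v => exists y, B y /\ v = dist_to_set d y A)).

Definition hausdorff_continuous {Y : Type} (dY : Y -> Y -> R) (T : R)
  (Z : R -> R -> Y -> Prop) : Prop :=
  forall t x, 0 <= t <= T -> forall eps, 0 < eps ->
  exists delta, 0 < delta /\ forall s y, 0 <= s <= T ->
    Rabs (s - t) < delta -> Rabs (y - x) < delta ->
    hausdorff_dist dY (Z s y) (Z t x) < eps.

Definition cont_RX {X : Type} (d : X -> X -> R) (h : R -> X -> R) : Prop :=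
  forall x w eps, 0 < eps -> exists delta, 0 < delta /\ forall y w',
    Rabs (y - x) < delta -> d w w' < delta -> Rabs (h y w' - h x w) < eps.

Definition cont_TRX {X : Type} (d : X -> X -> R) (T : R) (h : R -> R -> X -> R) : Prop :=
  forall t x w, 0 <= t <= T -> forall eps, 0 < eps ->
  exists delta, 0 < delta /\ forall s y w', 0 <= s <= T ->
    Rabs (s - t) < delta -> Rabs (y - x) < delta -> d w w' < delta ->
    Rabs (h s y w' - h t x w) < eps.

Definition Ham {W : Type} (a b : R -> W -> R) (f : R -> R -> W -> R)
  (t x p A : R) : R :=
  Rsup (fun v => exists w, v = / 2 * (b x w) ^ 2 * A + a x w * p + f t x w).

Definition Fop {W : Type} (T : R) (a b : R -> W -> R) (f : R -> R -> W -> R)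
  (g : R -> R) (t x r q p A l : R) : R :=
  if Rlt_dec t T then Rmin (- q - Ham a b f t x p A) (r - l)
  else Rmin (r - g x) (r - l).

Definition near7 (T delta t x r q p A l t' x' r' q' p' A' l' : R) : Prop :=
  0 <= t' <= T /\ Rabs (t' - t) < delta /\ Rabs (x' - x) < delta /\
  Rabs (r' - r) < delta /\ Rabs (q' - q) < delta /\ Rabs (p' - p) < delta /\
  Rabs (A' - A) < delta /\ Rabs (l' - l) < delta.

(** Lower semicontinuous envelope: F_*(z) = liminf_{z' -> z} F(z')
    = sup of the local lower bounds of F near z. *)
Definition lower_env (T : R) (F : R -> R -> R -> R -> R -> R -> R -> R)
  (t x r q p A l : R) : R :=
  Rsup (fun v => exists delta, 0 < delta /\
    forall t' x' r' q' p' A' l', near7 T delta t x r q p A l t' x' r' q' p' A' l' ->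
      v <= F t' x' r' q' p' A' l').

Definition upper_env (T : R) (F : R -> R -> R -> R -> R -> R -> R -> R)
  (t x r q p A l : R) : R :=
  Rinf (fun v => exists delta, 0 < delta /\
    forall t' x' r' q' p' A' l', near7 T delta t x r q p A l t' x' r' q' p' A' l' ->
      F t' x' r' q' p' A' l' <= v).

Definition Mop {Y : Type} (Z : R -> R -> Y -> Prop) (Gam K : R -> R -> Y -> R)
  (V : R -> R -> R) (t x : R) : R :=
  Rsup (fun v => exists z, Z t x z /\ v = V t (Gam t x z) + K t x z).

Definition Mg {Y : Type} (T : R) (Z : R -> R -> Y -> Prop) (Gam K : R -> R -> Y -> R)
  (g : R -> R) (x : R) : R :=
  Rsup (fun v => exists z, Z T x z /\ v = g (Gam T x z) + K T x z).

Definition open2 (O : R -> R -> Prop) : Prop :=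
  forall t x, O t x -> exists delta, 0 < delta /\
    forall s y, Rabs (s - t) < delta -> Rabs (y - x) < delta -> O s y.

Definition cont2_on (O : R -> R -> Prop) (h : R -> R -> R) : Prop :=
  forall t x, O t x -> forall eps, 0 < eps -> exists delta, 0 < delta /\
    forall s y, O s y -> Rabs (s - t) < delta -> Rabs (y - x) < delta ->
      Rabs (h s y - h t x) < eps.

Definition C12_on (O : R -> R -> Prop) (phi phit phix phixx : R -> R -> R) : Prop :=
  open2 O /\
  (forall t x, O t x ->
     derivable_pt_lim (fun s => phi s x) t (phit t x) /\
     derivable_pt_lim (fun y => phi t y) x (phix t x) /\
     derivable_pt_lim (fun y => phix t y) x (phixx t x)) /\
  cont2_on O phi /\ cont2_on O phit /\ cont2_on O phix /\ cont2_on O phixx.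

Definition usc_on (T : R) (V : R -> R -> R) : Prop :=
  forall t x, 0 <= t <= T -> forall eps, 0 < eps -> exists delta, 0 < delta /\
    forall s y, 0 <= s <= T -> Rabs (s - t) < delta -> Rabs (y - x) < delta ->
      V s y < V t x + eps.

Definition lsc_on (T : R) (V : R -> R -> R) : Prop :=
  forall t x, 0 <= t <= T -> forall eps, 0 < eps -> exists delta, 0 < delta /\
    forall s y, 0 <= s <= T -> Rabs (s - t) < delta -> Rabs (y - x) < delta ->
      V t x - eps < V s y.

Definition loc_max_on (T : R) (h : R -> R -> R) (t x : R) : Prop :=
  exists delta, 0 < delta /\ forall s y, 0 <= s <= T ->
    Rabs (s - t) < delta -> Rabs (y - x) < delta -> h s y <= h t x.

Definition loc_min_on (T : R) (h : R -> R -> R) (t x : R) : Prop :=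
  exists delta, 0 < delta /\ forall s y, 0 <= s <= T ->
    Rabs (s - t) < delta -> Rabs (y - x) < delta -> h t x <= h s y.

Definition visc_sub {W Y : Type} (T : R) (a b : R -> W -> R) (f : R -> R -> W -> R)
  (g : R -> R) (Z : R -> R -> Y -> Prop) (Gam K : R -> R -> Y -> R)
  (V : R -> R -> R) : Prop :=
  usc_on T V /\
  forall (O : R -> R -> Prop) (phi phit phix phixx : R -> R -> R),
    C12_on O phi phit phix phixx ->
    (forall t x, 0 <= t <= T -> O t x) ->
    forall t x, 0 <= t <= T ->
      loc_max_on T (fun s y => V s y - phi s y) t x ->
      lower_env T (Fop T a b f g) t x (V t x) (phit t x) (phix t x) (phixx t x)
        (Mop Z Gam K V t x) <= 0.

Definition visc_super {W Y : Type} (T : R) (a b : R -> W -> R) (f : R -> R -> W -> R)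
  (g : R -> R) (Z : R -> R -> Y -> Prop) (Gam K : R -> R -> Y -> R)
  (V : R -> R -> R) : Prop :=
  lsc_on T V /\
  forall (O : R -> R -> Prop) (phi phit phix phixx : R -> R -> R),
    C12_on O phi phit phix phixx ->
    (forall t x, 0 <= t <= T -> O t x) ->
    forall t x, 0 <= t <= T ->
      loc_min_on T (fun s y => V s y - phi s y) t x ->
      0 <= upper_env T (Fop T a b f g) t x (V t x) (phit t x) (phix t x) (phixx t x)
        (Mop Z Gam K V t x).

Definition bounded_on (T : R) (V : R -> R -> R) : Prop :=
  exists M, forall t x, 0 <= t <= T -> Rabs (V t x) <= M.

(* Main.v *)
Require Import Defs.
From Stdlib Require Import Reals.
From Stdlib Require Import Lra Lia ClassicalEpsilon.
Open Scope R_scope.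

(** If U > V somewhere, then U still exceeds the strict supersolution
    v = (1 - lam) V + lam (G + (M + 1)(T - t)).  At a maximum of U - v - th x^2 the strict
    gap in the obstacle inequality excludes U <= MU, and U <= g <= V at the terminal time,
    so near that point both functions satisfy the parabolic inequality, and doubling of
    variables gives a contradiction.

    Ishii's lemma is obtained without the theorems of Alexandrov and Jensen, thanks to the
    single space dimension.  Let uh, wh be the sup-convolutions of the two functions and
    (X0, Y0) a maximum of uh + wh - N |X - Y|^2.  With al the infimum over 0 < tau <= r of
    the second difference quotients of uh(t0, .) at x0, and al' the same for wh, the maximum
    property gives al b^2 + al' c^2 <= 2 N (b - c)^2 for all b and c.  On the other hand, at a
    scale where the quotient is below A = al + r, a parabola of curvature A touches uh(t0, .)
    from above at an interior point, and this produces a parabolic jet of u with second-order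
    part A. *)

(** * Suprema and compactness *)

(** The equation has no zeroth-order term, so strictness has to be built in. The function
    [G + (M + 1) * (T - t)] is constant in space: it satisfies the parabolic inequality with margin
    1 because [f] is at most [M], the obstacle inequality with margin [- c] because [K] is at most
    [c < 0], and the terminal one because [g] is at most [G]. With weight [lam] these margins become
    [lam] and [- lam * c]. [Mop] is nonlocal, so its values at two doubled points cannot be compared
    as jets are. This is why the impulse alternative is removed near the maximum before doubling. In
    dimension one the second-order part is a single number, and two bounds on difference quotients
    replace twice differentiability. The lower bound [al] holds at every scale up to [r], so unequal
    steps in the two variables may be inserted in the doubling inequality. A quotient below [al + r]
    at one scale, however small, already yields a touching parabola. No limit in the doubling
    parameter is taken: all tolerances are explicit and fixed in the order in which they depend on
    each other. *)

Lemma Rabs_le_bounds (x c : R) : Rabs x <= c -> - c <= x <= c.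
Proof. unfold Rabs. destruct (Rcase_abs x); lra. Qed.

Lemma sq_le_of_abs (z r : R) : Rabs z <= r -> z ^ 2 <= r ^ 2.
Proof. intro H. rewrite <- (pow2_abs z). apply pow_incr. split; [apply Rabs_pos|auto]. Qed.

Lemma Rsup_lub (E : R -> Prop) (M : R) :
  (exists v, E v) -> (forall v, E v -> v <= M) -> is_lub E (Rsup E).
Proof.
  intros Hne HM. unfold Rsup.
  destruct (excluded_middle_informative (exists l, is_lub E l)) as [H | H].
  - exact (proj2_sig (constructive_indefinite_description _ H)).
  - exfalso. apply H.
    assert (Hb : bound E) by (exists M; exact HM).
    destruct (completeness E Hb Hne) as [l Hl]. now exists l.
Qed.

Lemma Rsup_ub (E : R -> Prop) (M v : R) :
  (forall u, E u -> u <= M) -> E v -> v <= Rsup E.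
Proof.
  intros HM Hv. destruct (Rsup_lub E M) as [H _]; eauto.
Qed.

Lemma Rsup_le (E : R -> Prop) (M : R) :
  (exists v, E v) -> (forall v, E v -> v <= M) -> Rsup E <= M.
Proof.
  intros Hne HM. destruct (Rsup_lub E M) as [_ H]; auto.
Qed.

Lemma Rsup_approx (E : R -> Prop) (M eps : R) :
  (exists v, E v) -> (forall v, E v -> v <= M) -> 0 < eps ->
  exists v, E v /\ Rsup E - eps < v.
Proof.
  intros Hne HM He. apply NNPP; intro Hn.
  assert (H : Rsup E <= Rsup E - eps); [ | lra].
  apply Rsup_le; auto. intros v Hv.
  destruct (Rle_dec v (Rsup E - eps)); auto.
  exfalso; apply Hn; exists v; split; auto; lra.
Qed.

Lemma extraction_ge (phi : nat -> nat) :
  (forall n, (phi n < phi (S n))%nat) -> forall n, (n <= phi n)%nat.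
Proof. intros H n; induction n as [|n IH]; [lia|]. specialize (H n); lia. Qed.

Lemma extraction_lt (phi : nat -> nat) :
  (forall n, (phi n < phi (S n))%nat) ->
  forall m n, (m < n)%nat -> (phi m < phi n)%nat.
Proof.
  intros H m n Hmn. induction Hmn as [|n Hmn IH]; [apply H|].
  specialize (H n); lia.
Qed.

Lemma inv_INR_small (eps : R) : 0 < eps ->
  exists N : nat, forall n, (N <= n)%nat -> / (INR n + 1) < eps.
Proof.
  intros He. destruct (archimed_cor1 eps He) as [N [HN HN0]].
  exists N. intros n Hn. eapply Rle_lt_trans; [|exact HN].
  apply Rinv_le_contravar.
  - now apply lt_0_INR.
  - apply le_INR in Hn. lra.
Qed.

(* Sequential form of the tube lemma. *)
Lemma compact_uniform {X : Type} (d : X -> X -> R) (A : X -> Prop)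
  (Q : R -> X -> Prop) :
  compact_set d A ->
  (forall e e' x, 0 < e' <= e -> Q e x -> Q e' x) ->
  (forall x, A x -> exists e, 0 < e /\ forall y, A y -> d y x < e -> Q e y) ->
  exists e, 0 < e /\ forall y, A y -> Q e y.
Proof.
  intros HA Hmono Hloc. apply NNPP; intro Hn.
  assert (Hbad : forall n : nat, exists y, A y /\ ~ Q (/ (INR n + 1)) y).
  { intro n. apply NNPP; intro Hn'. apply Hn. exists (/ (INR n + 1)). split.
    - apply Rinv_0_lt_compat. pose proof (pos_INR n); lra.
    - intros y Hy. apply NNPP; intro Hq. apply Hn'. now exists y. }
  destruct (choice _ Hbad) as [u Hu].
  destruct (HA u (fun n => proj1 (Hu n))) as [phi [l [Hphi [Hl Hcv]]]].
  destruct (Hloc l Hl) as [e [He Hq]].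
  destruct (Hcv e He) as [N1 HN1].
  destruct (inv_INR_small e He) as [N2 HN2].
  set (n := max N1 N2).
  apply (proj2 (Hu (phi n))). apply (Hmono e).
  - split; [apply Rinv_0_lt_compat; pose proof (pos_INR (phi n)); lra|].
    left. apply HN2. pose proof (extraction_ge phi Hphi n). lia.
  - apply Hq; [apply (proj1 (Hu (phi n)))|]. apply HN1. lia.
Qed.

Definition usc_within {X : Type} (d : X -> X -> R) (A : X -> Prop) (F : X -> R) : Prop :=
  forall x, A x -> forall eps, 0 < eps ->
  exists delta, 0 < delta /\ forall y, A y -> d y x < delta -> F y < F x + eps.

Definition cont_within {X : Type} (d : X -> X -> R) (A : X -> Prop) (F : X -> R) : Prop :=
  forall x, A x -> forall eps, 0 < eps ->
  exists delta, 0 < delta /\ forall y, A y -> d y x < delta -> Rabs (F y - F x) < eps.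

(** Two uses of [compact_uniform]: with the bounds [/ e] it shows that [F] is bounded above, and
    with the bounds [Rsup E - e] it shows that an unattained supremum could be lowered. *)
Lemma usc_max {X : Type} (d : X -> X -> R) (A : X -> Prop) (F : X -> R) :
  compact_set d A -> (exists x, A x) -> usc_within d A F ->
  exists x, A x /\ forall y, A y -> F y <= F x.
Proof.
  intros HA Hne HF.
  destruct (compact_uniform d A (fun e x => F x <= / e) HA) as [e0 [He0 Hb]].
  { intros e e' x Hee Hx. eapply Rle_trans; [exact Hx|].
    apply Rinv_le_contravar; lra. }
  { intros x Hx. destruct (HF x Hx 1 Rlt_0_1) as [dl [Hdl HF1]].
    set (m := Rabs (F x) + 1).
    assert (Hm : 0 < m) by (unfold m; pose proof (Rabs_pos (F x)); lra).
    exists (Rmin dl (/ m)). split.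
    - apply Rmin_glb_lt; auto. now apply Rinv_0_lt_compat.
    - intros y Hy Hyx. assert (Hy1 : d y x < dl).
      { eapply Rlt_le_trans; [exact Hyx|apply Rmin_l]. }
      specialize (HF1 y Hy Hy1).
      apply Rle_trans with m.
      + unfold m. pose proof (Rle_abs (F x)). lra.
      + rewrite <- (Rinv_inv m) at 1. apply Rinv_le_contravar.
        * apply Rmin_glb_lt; auto. now apply Rinv_0_lt_compat.
        * apply Rmin_r. }
  set (E := fun v => exists x, A x /\ v = F x).
  assert (HEne : exists v, E v) by (destruct Hne as [x Hx]; exists (F x), x; auto).
  assert (HEb : forall v, E v -> v <= / e0) by (intros v [x [Hx ->]]; auto).
  apply NNPP; intro Hn.
  assert (Hlt : forall x, A x -> F x < Rsup E).
  { intros x Hx. apply Rnot_le_lt; intro Hle. apply Hn. exists x; split; auto.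
    intros y Hy. eapply Rle_trans; [|exact Hle].
    eapply Rsup_ub; [exact HEb|]. now exists y. }
  destruct (compact_uniform d A (fun e x => F x <= Rsup E - e) HA) as [e1 [He1 Hb1]].
  { intros e e' x Hee Hx. lra. }
  { intros x Hx. specialize (Hlt x Hx).
    destruct (HF x Hx ((Rsup E - F x) / 2)) as [dl [Hdl HF1]]; [lra|].
    exists (Rmin dl ((Rsup E - F x) / 2)). split.
    - apply Rmin_glb_lt; auto. lra.
    - intros y Hy Hyx.
      assert (Hy1 : d y x < dl) by (eapply Rlt_le_trans; [exact Hyx|apply Rmin_l]).
      specialize (HF1 y Hy Hy1).
      pose proof (Rmin_r dl ((Rsup E - F x) / 2)). lra. }
  assert (H : Rsup E <= Rsup E - e1); [|lra].
  apply Rsup_le; auto. intros v [x [Hx ->]]; auto.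
Qed.

Definition dprod {X X' : Type} (d : X -> X -> R) (d' : X' -> X' -> R)
  (p q : X * X') : R := Rmax (d (fst p) (fst q)) (d' (snd p) (snd q)).

Lemma compact_prod {X X' : Type} (d : X -> X -> R) (d' : X' -> X' -> R)
  (A : X -> Prop) (A' : X' -> Prop) :
  compact_set d A -> compact_set d' A' ->
  compact_set (dprod d d') (fun p => A (fst p) /\ A' (snd p)).
Proof.
  intros HA HA' u Hu.
  destruct (HA (fun n => fst (u n)) (fun n => proj1 (Hu n)))
    as [phi [l [Hphi [Hl Hcv]]]].
  destruct (HA' (fun n => snd (u (phi n))) (fun n => proj2 (Hu (phi n))))
    as [psi [l' [Hpsi [Hl' Hcv']]]].
  exists (fun n => phi (psi n)), (l, l'). repeat split; auto.
  - intro n. now apply extraction_lt.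
  - intros eps He. destruct (Hcv eps He) as [N1 H1]. destruct (Hcv' eps He) as [N2 H2].
    exists (max N1 N2). intros n Hn. apply Rmax_lub_lt.
    + apply H1. pose proof (extraction_ge psi Hpsi n). lia.
    + apply H2. lia.
Qed.

Lemma compact_interval (lo hi : R) :
  compact_set Rdist (fun x => lo <= x <= hi).
Proof.
  intros u Hu.
  destruct (Bolzano_Weierstrass u (fun x => lo <= x <= hi) (compact_P3 lo hi) Hu)
    as [l Hl].
  assert (Hnext : forall n N : nat, exists p : nat,
            (N < p)%nat /\ Rdist (u p) l < / (INR n + 1)).
  { intros n N.
    assert (Hp : 0 < / (INR n + 1))
      by (apply Rinv_0_lt_compat; pose proof (pos_INR n); lra).
    destruct (Hl (disc l (mkposreal _ Hp)) (S N)) as [p [Hp1 Hp2]].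
    - exists (mkposreal _ Hp). intros x Hx; exact Hx.
    - exists p. split; [lia|exact Hp2]. }
  (* The choice function receives both the stage and the last index chosen, so the recursion below
     yields an increasing extraction. *)
  destruct (choice (fun (a : nat * nat) p => (snd a < p)%nat /\
              Rdist (u p) l < / (INR (fst a) + 1))) as [nx Hnx].
  { intros [n N]. apply Hnext. }
  set (phi := fix phi n := match n with O => nx (O, O) | S m => nx (S m, phi m) end).
  assert (Hphi : forall n, (phi n < phi (S n))%nat).
  { intro n. apply (proj1 (Hnx (S n, phi n))). }
  assert (Hcv : seq_cv Rdist (fun n => u (phi n)) l).
  { intros eps He. destruct (inv_INR_small eps He) as [N HN].
    exists N. intros n Hn. eapply Rlt_trans; [|apply (HN n Hn)].
    destruct n as [|n]; [apply (proj2 (Hnx (O, O)))|apply (proj2 (Hnx (S n, phi n)))]. }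
  exists phi, l. repeat split; auto.
  - apply Rnot_lt_le; intro H. destruct (Hcv (lo - l)) as [N HN]; [lra|].
    specialize (HN N (le_n N)). unfold Rdist in HN. apply Rabs_def2 in HN.
    specialize (Hu (phi N)). lra.
  - apply Rnot_lt_le; intro H. destruct (Hcv (l - hi)) as [N HN]; [lra|].
    specialize (HN N (le_n N)). unfold Rdist in HN. apply Rabs_def2 in HN.
    specialize (Hu (phi N)). lra.
Qed.

(** * Calculus of continuity and upper semicontinuity on a subset *)

Lemma usc_plus {X : Type} (d : X -> X -> R) (A : X -> Prop) (F G : X -> R) :
  usc_within d A F -> usc_within d A G -> usc_within d A (fun x => F x + G x).
Proof.
  intros HF HG x Hx eps He.
  destruct (HF x Hx (eps / 2)) as [d1 [Hd1 H1]]; [lra|].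
  destruct (HG x Hx (eps / 2)) as [d2 [Hd2 H2]]; [lra|].
  exists (Rmin d1 d2). split; [now apply Rmin_glb_lt|].
  intros y Hy Hyx.
  specialize (H1 y Hy (Rlt_le_trans _ _ _ Hyx (Rmin_l _ _))).
  specialize (H2 y Hy (Rlt_le_trans _ _ _ Hyx (Rmin_r _ _))). lra.
Qed.

Lemma cont_usc {X : Type} (d : X -> X -> R) (A : X -> Prop) (F : X -> R) :
  cont_within d A F -> usc_within d A F.
Proof.
  intros HF x Hx eps He. destruct (HF x Hx eps He) as [dl [Hdl H]].
  exists dl; split; auto. intros y Hy Hyx. specialize (H y Hy Hyx).
  apply Rabs_def2 in H. lra.
Qed.

Lemma cont_cst {X : Type} (d : X -> X -> R) (A : X -> Prop) (c : R) :
  cont_within d A (fun _ => c).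
Proof.
  intros x _ eps He. exists 1; split; [lra|]. intros y _ _.
  rewrite Rminus_diag_eq, Rabs_R0; auto.
Qed.

Lemma cont_plus {X : Type} (d : X -> X -> R) (A : X -> Prop) (F G : X -> R) :
  cont_within d A F -> cont_within d A G -> cont_within d A (fun x => F x + G x).
Proof.
  intros HF HG x Hx eps He.
  destruct (HF x Hx (eps / 2)) as [d1 [Hd1 H1]]; [lra|].
  destruct (HG x Hx (eps / 2)) as [d2 [Hd2 H2]]; [lra|].
  exists (Rmin d1 d2). split; [now apply Rmin_glb_lt|].
  intros y Hy Hyx.
  specialize (H1 y Hy (Rlt_le_trans _ _ _ Hyx (Rmin_l _ _))).
  specialize (H2 y Hy (Rlt_le_trans _ _ _ Hyx (Rmin_r _ _))).
  apply Rabs_def2 in H1. apply Rabs_def2 in H2. apply Rabs_def1; lra.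
Qed.

Lemma cont_minus {X : Type} (d : X -> X -> R) (A : X -> Prop) (F G : X -> R) :
  cont_within d A F -> cont_within d A G -> cont_within d A (fun x => F x - G x).
Proof.
  intros HF HG x Hx eps He.
  destruct (HF x Hx (eps / 2)) as [d1 [Hd1 H1]]; [lra|].
  destruct (HG x Hx (eps / 2)) as [d2 [Hd2 H2]]; [lra|].
  exists (Rmin d1 d2). split; [now apply Rmin_glb_lt|].
  intros y Hy Hyx.
  specialize (H1 y Hy (Rlt_le_trans _ _ _ Hyx (Rmin_l _ _))).
  specialize (H2 y Hy (Rlt_le_trans _ _ _ Hyx (Rmin_r _ _))).
  apply Rabs_def2 in H1. apply Rabs_def2 in H2. apply Rabs_def1; lra.
Qed.

Lemma cont_mult {X : Type} (d : X -> X -> R) (A : X -> Prop) (F G : X -> R) :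
  cont_within d A F -> cont_within d A G -> cont_within d A (fun x => F x * G x).
Proof.
  intros HF HG x Hx eps He.
  set (m := Rabs (F x) + Rabs (G x) + 1).
  assert (Hm : 1 <= m)
    by (unfold m; pose proof (Rabs_pos (F x)); pose proof (Rabs_pos (G x)); lra).
  set (e := Rmin 1 (eps / (2 * m))).
  assert (He' : 0 < e).
  { apply Rmin_glb_lt; [lra|]. apply Rdiv_lt_0_compat; lra. }
  destruct (HF x Hx e He') as [d1 [Hd1 H1]].
  destruct (HG x Hx e He') as [d2 [Hd2 H2]].
  exists (Rmin d1 d2). split; [now apply Rmin_glb_lt|].
  intros y Hy Hyx.
  specialize (H1 y Hy (Rlt_le_trans _ _ _ Hyx (Rmin_l _ _))).
  specialize (H2 y Hy (Rlt_le_trans _ _ _ Hyx (Rmin_r _ _))).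
  replace (F y * G y - F x * G x)
    with ((F y - F x) * (G y - G x) + (F x * (G y - G x) + (F y - F x) * G x)) by ring.
  assert (Hem : e * m <= eps / 2).
  { assert (e <= eps / (2 * m)) by apply Rmin_r.
    replace (eps / 2) with (eps / (2 * m) * m) by (field; lra).
    apply Rmult_le_compat_r; lra. }
  assert (He1 : e <= 1) by apply Rmin_l.
  eapply Rle_lt_trans; [apply Rabs_triang|].
  eapply Rle_lt_trans; [apply Rplus_le_compat_l, Rabs_triang|].
  rewrite !Rabs_mult.
  assert (HmE : Rabs (F x) + Rabs (G x) + 1 = m) by reflexivity.
  pose proof (Rabs_pos (F x)); pose proof (Rabs_pos (G x)).
  pose proof (Rabs_pos (F y - F x)); pose proof (Rabs_pos (G y - G x)).
  nra.
Qed.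

Lemma cont_pow2 {X : Type} (d : X -> X -> R) (A : X -> Prop) (F : X -> R) :
  cont_within d A F -> cont_within d A (fun x => F x ^ 2).
Proof.
  intros HF. simpl. apply cont_mult; auto. apply cont_mult; auto. apply cont_cst.
Qed.

Ltac cont_tac := repeat first
  [assumption | apply cont_cst | apply cont_minus | apply cont_plus | apply cont_pow2
  | apply cont_mult].

Lemma cont_fst {X X' : Type} (d : X -> X -> R) (d' : X' -> X' -> R)
  (A : X -> Prop) (A' : X' -> Prop) (F : X -> R) :
  cont_within d A F ->
  cont_within (dprod d d') (fun p => A (fst p) /\ A' (snd p)) (fun p => F (fst p)).
Proof.
  intros HF x [Hx _] eps He. destruct (HF (fst x) Hx eps He) as [dl [Hdl H]].
  exists dl; split; auto. intros y [Hy _] Hyx. apply H; auto.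
  eapply Rle_lt_trans; [apply Rmax_l|exact Hyx].
Qed.

Lemma cont_snd {X X' : Type} (d : X -> X -> R) (d' : X' -> X' -> R)
  (A : X -> Prop) (A' : X' -> Prop) (F : X' -> R) :
  cont_within d' A' F ->
  cont_within (dprod d d') (fun p => A (fst p) /\ A' (snd p)) (fun p => F (snd p)).
Proof.
  intros HF x [_ Hx] eps He. destruct (HF (snd x) Hx eps He) as [dl [Hdl H]].
  exists dl; split; auto. intros y [_ Hy] Hyx. apply H; auto.
  eapply Rle_lt_trans; [apply Rmax_r|exact Hyx].
Qed.

Lemma usc_fst {X X' : Type} (d : X -> X -> R) (d' : X' -> X' -> R)
  (A : X -> Prop) (A' : X' -> Prop) (F : X -> R) :
  usc_within d A F ->
  usc_within (dprod d d') (fun p => A (fst p) /\ A' (snd p)) (fun p => F (fst p)).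
Proof.
  intros HF x [Hx _] eps He. destruct (HF (fst x) Hx eps He) as [dl [Hdl H]].
  exists dl; split; auto. intros y [Hy _] Hyx. apply H; auto.
  eapply Rle_lt_trans; [apply Rmax_l|exact Hyx].
Qed.

Lemma usc_snd {X X' : Type} (d : X -> X -> R) (d' : X' -> X' -> R)
  (A : X -> Prop) (A' : X' -> Prop) (F : X' -> R) :
  usc_within d' A' F ->
  usc_within (dprod d d') (fun p => A (fst p) /\ A' (snd p)) (fun p => F (snd p)).
Proof.
  intros HF x [_ Hx] eps He. destruct (HF (snd x) Hx eps He) as [dl [Hdl H]].
  exists dl; split; auto. intros y [_ Hy] Hyx. apply H; auto.
  eapply Rle_lt_trans; [apply Rmax_r|exact Hyx].
Qed.

Lemma cont_id (A : R -> Prop) : cont_within Rdist A (fun x => x).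
Proof. intros x _ eps He. exists eps; split; auto. Qed.

(** Turns the one-sided Hausdorff excess, given as a supremum of infima, into an actual nearby
    point. *)
Lemma hausdorff_near {X : Type} (d : X -> X -> R) (A B : X -> Prop) (delta : R) :
  is_metric d -> compact_set d A -> (exists x, A x) -> (exists y, B y) ->
  Rsup (fun v => exists x, A x /\ v = dist_to_set d x B) < delta ->
  forall x, A x -> exists y, B y /\ d x y < delta.
Proof.
  intros [Hd0 [Hdeq [Hsym Htri]]] HA Hne [y0 Hy0] Hlt x Hx.
  assert (Hdist : forall z, forall M, (forall y, B y -> M <= d z y) -> M <= dist_to_set d z B).
  { intros z M HM. unfold dist_to_set, Rinf.
    assert (H : Rsup (fun v => exists y, B y /\ - v = d z y) <= - M); [|lra].
    apply Rsup_le.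
    - exists (- d z y0), y0. split; auto. ring.
    - intros v [y [Hy Hv]]. specialize (HM y Hy). lra. }
  assert (Hub : forall z, dist_to_set d z B <= d z y0).
  { intro z. unfold dist_to_set, Rinf.
    assert (H : - d z y0 <= Rsup (fun v => exists y, B y /\ - v = d z y)); [|lra].
    apply (Rsup_ub _ 0).
    - intros v [y [Hy Hv]]. specialize (Hd0 z y). lra.
    - exists y0. split; auto. ring. }
  (* [Rsup] falls back to 0 on unbounded sets. Compactness of [A] bounds the distances, so the
     supremum really dominates [dist_to_set d x B]. *)
  destruct (usc_max d A (fun z => d z y0)) as [m [Hm Hmax]]; auto.
  { intros z Hz eps He. exists eps; split; auto. intros y Hy Hyz.
    specialize (Htri y z y0). lra. }
  apply NNPP; intro Hn.
  assert (H1 : delta <= dist_to_set d x B).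
  { apply Hdist. intros y Hy. apply Rnot_lt_le. intro Hl. apply Hn. now exists y. }
  assert (H2 : dist_to_set d x B <= Rsup (fun v => exists x, A x /\ v = dist_to_set d x B)).
  { apply (Rsup_ub _ (d m y0)).
    - intros v [z [Hz ->]]. eapply Rle_trans; [apply Hub|]. now apply Hmax.
    - now exists x. }
  lra.
Qed.

(** * The Hamiltonian *)

Record coef_bounds {W : Type} (T : R) (a b : R -> W -> R) (f : R -> R -> W -> R)
  (L M : R) : Prop := {
  cb_L : 0 <= L;
  cb_M : 0 <= M;
  cb_alip : forall x y w, Rabs (a x w - a y w) <= L * Rabs (x - y);
  cb_blip : forall x y w, Rabs (b x w - b y w) <= L * Rabs (x - y);
  cb_a : forall x w, Rabs (a x w) <= L * (1 + Rabs x);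
  cb_b : forall x w, Rabs (b x w) <= L * (1 + Rabs x);
  cb_f : forall t x w, 0 <= t <= T -> Rabs (f t x w) <= M }.

Lemma compact_bounded {W : Type} (dW : W -> W -> R) (h : R -> W -> R) (x : R) :
  inhabited W -> compact_set dW (fun _ => True) -> is_metric dW -> cont_RX dW h ->
  exists m, forall w, Rabs (h x w) <= m.
Proof.
  intros [w0] HW [_ [_ [Hsym _]]] Hh.
  assert (Hu : usc_within dW (fun _ => True) (fun w => Rabs (h x w))).
  { intros w _ eps He. destruct (Hh x w eps He) as [dl [Hdl H]].
    exists dl; split; auto. intros w' _ Hw.
    assert (Hx : Rabs (x - x) < dl) by (rewrite Rminus_diag, Rabs_R0; auto).
    rewrite Hsym in Hw. specialize (H x w' Hx Hw).
    pose proof (Rabs_triang_inv (h x w') (h x w)). lra. }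
  destruct (usc_max dW _ _ HW (ex_intro _ w0 I) Hu) as [w [_ Hw]].
  exists (Rabs (h x w)). auto.
Qed.

Lemma coef_bounds_exist {W : Type} (dW : W -> W -> R) (T : R)
  (a b : R -> W -> R) (f : R -> R -> W -> R) :
  inhabited W -> compact_set dW (fun _ => True) -> is_metric dW ->
  cont_RX dW a -> cont_RX dW b ->
  (exists M, forall t x w, 0 <= t <= T -> Rabs (f t x w) <= M) ->
  (exists C, forall x y w,
      Rabs (a x w - a y w) + Rabs (b x w - b y w) <= C * Rabs (x - y)) ->
  exists L M, coef_bounds T a b f L M.
Proof.
  intros Hi HW Hd Ha Hb [M HM] [C HC].
  destruct (compact_bounded dW a 0 Hi HW Hd Ha) as [ma Hma].
  destruct (compact_bounded dW b 0 Hi HW Hd Hb) as [mb Hmb].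
  destruct Hi as [w0].
  set (L := Rabs C + Rabs ma + Rabs mb).
  assert (HL : Rabs C <= L /\ ma <= L /\ mb <= L).
  { unfold L. pose proof (Rle_abs ma). pose proof (Rle_abs mb).
    pose proof (Rabs_pos ma). pose proof (Rabs_pos mb). pose proof (Rabs_pos C). lra. }
  destruct HL as [HL1 [HL2 HL3]].
  assert (HL0 : 0 <= L) by (pose proof (Rabs_pos C); lra).
  assert (Hlip : forall x y w,
     Rabs (a x w - a y w) <= L * Rabs (x - y) /\ Rabs (b x w - b y w) <= L * Rabs (x - y)).
  { intros x y w. specialize (HC x y w).
    assert (C * Rabs (x - y) <= L * Rabs (x - y)).
    { apply Rmult_le_compat_r; [apply Rabs_pos|]. pose proof (Rle_abs C); lra. }
    pose proof (Rabs_pos (a x w - a y w)). pose proof (Rabs_pos (b x w - b y w)). lra. }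
  exists L, (Rabs M). split; auto.
  - apply Rabs_pos.
  - intros; apply Hlip.
  - intros; apply Hlip.
  - intros x w. destruct (Hlip x 0 w) as [H _]. rewrite Rminus_0_r in H.
    specialize (Hma w). pose proof (Rabs_triang_inv (a x w) (a 0 w)). lra.
  - intros x w. destruct (Hlip x 0 w) as [_ H]. rewrite Rminus_0_r in H.
    specialize (Hmb w). pose proof (Rabs_triang_inv (b x w) (b 0 w)). lra.
  - intros t x w Ht. specialize (HM t x w Ht). pose proof (Rle_abs M). lra.
Qed.

(** Hamiltonians at two points are compared by inserting the same nearly optimal control in both, so
    the modulus of [f] must not depend on [w]. Compactness of [W] provides this. *)
Lemma f_uniform {W : Type} (dW : W -> W -> R) (T : R) (f : R -> R -> W -> R) (t x eps : R) :
  compact_set dW (fun _ => True) -> is_metric dW -> cont_TRX dW T f ->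
  0 <= t <= T -> 0 < eps ->
  exists delta, 0 < delta /\ forall s y, 0 <= s <= T ->
    Rabs (s - t) < delta -> Rabs (y - x) < delta ->
    forall w, Rabs (f s y w - f t x w) < eps.
Proof.
  intros HW Hd Hf Ht He.
  assert (Hsym : forall u v, dW u v = dW v u) by (apply Hd).
  assert (Hrefl : forall u, dW u u = 0) by (intro u; now apply (proj1 (proj2 Hd))).
  destruct (compact_uniform dW (fun _ => True) (fun e w => forall s y, 0 <= s <= T ->
    Rabs (s - t) < e -> Rabs (y - x) < e -> Rabs (f s y w - f t x w) < eps) HW)
    as [dl [Hdl H]].
  - intros e e' w Hee Hq s y Hs H1 H2. apply Hq; auto; lra.
  - intros w _. destruct (Hf t x w Ht (eps / 2)) as [dl [Hdl H]]; [lra|].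
    exists dl; split; auto. intros w' _ Hw s y Hs H1 H2. rewrite Hsym in Hw.
    assert (A1 := H s y w' Hs H1 H2 Hw).
    assert (A2 : Rabs (f t x w' - f t x w) < eps / 2).
    { apply (H t x w'); auto; rewrite Rminus_diag, Rabs_R0; auto. }
    apply Rabs_def2 in A1. apply Rabs_def2 in A2. apply Rabs_def1; lra.
  - exists dl; split; auto.
Qed.

Lemma Ham_term_bound {W : Type} (T : R) (a b : R -> W -> R) (f : R -> R -> W -> R)
  (L M t x p A : R) (w : W) :
  coef_bounds T a b f L M -> 0 <= t <= T ->
  Rabs (/ 2 * (b x w) ^ 2 * A + a x w * p + f t x w) <=
  (L * (1 + Rabs x)) ^ 2 * Rabs A + L * (1 + Rabs x) * Rabs p + M.
Proof.
  intros [HL HM _ _ Ha Hb Hf] Ht.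
  specialize (Ha x w). specialize (Hb x w). specialize (Hf t x w Ht).
  set (m := L * (1 + Rabs x)) in *.
  eapply Rle_trans; [apply Rabs_triang|].
  apply Rplus_le_compat; auto.
  eapply Rle_trans; [apply Rabs_triang|].
  apply Rplus_le_compat.
  - rewrite !Rabs_mult, <- RPow_abs, (Rabs_pos_eq (/ 2)) by lra.
    apply Rmult_le_compat_r; [apply Rabs_pos|].
    pose proof (Rabs_pos (b x w)). nra.
  - rewrite Rabs_mult. apply Rmult_le_compat_r; auto. apply Rabs_pos.
Qed.

Lemma Ham_ub {W : Type} (T : R) (a b : R -> W -> R) (f : R -> R -> W -> R)
  (L M t x p A : R) (w : W) :
  coef_bounds T a b f L M -> 0 <= t <= T ->
  / 2 * (b x w) ^ 2 * A + a x w * p + f t x w <= Ham a b f t x p A.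
Proof.
  intros HB Ht. unfold Ham. eapply Rsup_ub; [|now exists w].
  intros v [w' ->]. eapply Rle_trans; [apply Rle_abs|].
  apply (Ham_term_bound T a b f L M t x p A w' HB Ht).
Qed.

Lemma Ham_approx {W : Type} (T : R) (a b : R -> W -> R) (f : R -> R -> W -> R)
  (L M t x p A eps : R) :
  inhabited W -> coef_bounds T a b f L M -> 0 <= t <= T -> 0 < eps ->
  exists w, Ham a b f t x p A - eps < / 2 * (b x w) ^ 2 * A + a x w * p + f t x w.
Proof.
  intros [w0] HB Ht He.
  destruct (Rsup_approx (fun v => exists w, v = / 2 * (b x w) ^ 2 * A + a x w * p + f t x w)
    ((L * (1 + Rabs x)) ^ 2 * Rabs A + L * (1 + Rabs x) * Rabs p + M) eps) as [v [[w ->] Hw]];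
    auto.
  - eexists; now exists w0.
  - intros v [w ->]. eapply Rle_trans; [apply Rle_abs|].
    apply (Ham_term_bound T a b f L M t x p A w HB Ht).
  - now exists w.
Qed.

Lemma Ham_bound {W : Type} (T : R) (a b : R -> W -> R) (f : R -> R -> W -> R)
  (L M t x p A : R) :
  inhabited W -> coef_bounds T a b f L M -> 0 <= t <= T ->
  Rabs (Ham a b f t x p A) <=
  (L * (1 + Rabs x)) ^ 2 * Rabs A + L * (1 + Rabs x) * Rabs p + M.
Proof.
  intros Hi HB Ht. destruct Hi as [w0].
  set (m := (L * (1 + Rabs x)) ^ 2 * Rabs A + L * (1 + Rabs x) * Rabs p + M).
  assert (Hm : forall w, Rabs (/ 2 * (b x w) ^ 2 * A + a x w * p + f t x w) <= m)
    by (intro w; apply (Ham_term_bound T a b f L M t x p A w HB Ht)).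
  apply Rabs_le. split.
  - eapply Rle_trans; [|apply (Ham_ub T a b f L M t x p A w0 HB Ht)].
    specialize (Hm w0). apply Rabs_le_bounds in Hm. lra.
  - unfold Ham. apply Rsup_le; [eexists; now exists w0|].
    intros v [w ->]. eapply Rle_trans; [apply Rle_abs|auto].
Qed.

Lemma Ham_cont {W : Type} (dW : W -> W -> R) (T : R)
  (a b : R -> W -> R) (f : R -> R -> W -> R) (L M t x p A eps : R) :
  inhabited W -> compact_set dW (fun _ => True) -> is_metric dW -> cont_TRX dW T f ->
  coef_bounds T a b f L M -> 0 <= t <= T -> 0 < eps ->
  exists delta, 0 < delta /\ forall t' x' p' A', 0 <= t' <= T ->
    Rabs (t' - t) < delta -> Rabs (x' - x) < delta ->
    Rabs (p' - p) < delta -> Rabs (A' - A) < delta ->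
    Rabs (Ham a b f t' x' p' A' - Ham a b f t x p A) <= eps.
Proof.
  intros Hi HW Hd Hf HB Ht He.
  destruct (f_uniform dW T f t x (eps / 4) HW Hd Hf Ht) as [df [Hdf Hfu]]; [lra|].
  assert (HB' := HB). destruct HB' as [HL HM Hal Hbl Ha Hb _].
  set (m := L * (2 + Rabs x)).
  (* The four summands are the coefficients of [dl] in [E1] to [E4] below. The 2 in [m] and the
     [+ 1] on [Rabs A] and [Rabs p] absorb displacements of size at most 1. *)
  set (k := L * m * (Rabs A + 1) + m * m + L * (Rabs p + 1) + m).
  pose proof (Rabs_pos x) as Hx0. pose proof (Rabs_pos A) as HA0.
  pose proof (Rabs_pos p) as Hp0.
  assert (Hm : 0 <= m) by (apply Rmult_le_pos; lra).
  assert (Hk : 0 <= k).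
  { assert (0 <= L * m * (Rabs A + 1)) by (apply Rmult_le_pos; [apply Rmult_le_pos|]; lra).
    assert (0 <= L * (Rabs p + 1)) by (apply Rmult_le_pos; lra).
    unfold k. nra. }
  set (dl := Rmin (Rmin 1 df) (eps / (4 * (k + 1)))).
  assert (Hdl : 0 < dl).
  { apply Rmin_glb_lt; [apply Rmin_glb_lt; lra|apply Rdiv_lt_0_compat; lra]. }
  assert (Hdl1 : dl <= 1)
    by (eapply Rle_trans; [apply Rmin_l|apply Rmin_l]).
  assert (Hdl2 : dl <= df)
    by (eapply Rle_trans; [apply Rmin_l|apply Rmin_r]).
  assert (Hdl3 : dl * k <= eps / 4).
  { assert (dl <= eps / (4 * (k + 1))) by apply Rmin_r.
    assert (dl * (k + 1) <= eps / 4).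
    { replace (eps / 4) with (eps / (4 * (k + 1)) * (k + 1)) by (field; lra).
      apply Rmult_le_compat_r; lra. }
    nra. }
  exists dl; split; auto.
  intros t' x' p' A' Ht' Htd Hxd Hpd HAd.
  assert (Hterm : forall w, Rabs ((/ 2 * (b x' w) ^ 2 * A' + a x' w * p' + f t' x' w)
      - (/ 2 * (b x w) ^ 2 * A + a x w * p + f t x w)) <= eps / 2).
  { intro w.
    assert (F := Hfu t' x' Ht' ltac:(lra) ltac:(lra) w).
    pose proof (Rabs_triang_inv x' x) as Hx'.
    assert (Hax : Rabs (a x w) <= m).
    { eapply Rle_trans; [apply Ha|]. apply Rmult_le_compat_l; lra. }
    assert (Hbx : Rabs (b x w) <= m).
    { eapply Rle_trans; [apply Hb|]. apply Rmult_le_compat_l; lra. }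
    assert (Hbx' : Rabs (b x' w) <= m).
    { eapply Rle_trans; [apply Hb|]. apply Rmult_le_compat_l; lra. }
    assert (Da : Rabs (a x' w - a x w) <= L * dl).
    { eapply Rle_trans; [apply Hal|]. apply Rmult_le_compat_l; lra. }
    assert (Db : Rabs (b x' w - b x w) <= L * dl).
    { eapply Rle_trans; [apply Hbl|]. apply Rmult_le_compat_l; lra. }
    assert (HA' : Rabs A' <= Rabs A + 1) by (pose proof (Rabs_triang_inv A' A); lra).
    assert (Hp' : Rabs p' <= Rabs p + 1) by (pose proof (Rabs_triang_inv p' p); lra).
    replace (/ 2 * b x' w ^ 2 * A' + a x' w * p' + f t' x' w -
       (/ 2 * b x w ^ 2 * A + a x w * p + f t x w)) with
      (((/ 2 * ((b x' w - b x w) * (b x' w + b x w)) * A' + / 2 * (b x w * b x w) * (A' - A))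
       + ((a x' w - a x w) * p' + a x w * (p' - p))) + (f t' x' w - f t x w)) by ring.
    eapply Rle_trans; [apply Rabs_triang|].
    assert (E1 : Rabs (/ 2 * ((b x' w - b x w) * (b x' w + b x w)) * A')
                 <= L * dl * m * (Rabs A + 1)).
    { rewrite !Rabs_mult, (Rabs_pos_eq (/ 2)) by lra.
      assert (Rabs (b x' w + b x w) <= 2 * m)
        by (eapply Rle_trans; [apply Rabs_triang|lra]).
      assert (Rabs (b x' w - b x w) * Rabs (b x' w + b x w) <= L * dl * (2 * m))
        by (apply Rmult_le_compat; auto using Rabs_pos).
      apply Rmult_le_compat; auto using Rabs_pos; [|lra].
      apply Rmult_le_pos; [lra|apply Rmult_le_pos; apply Rabs_pos]. }
    assert (E2 : Rabs (/ 2 * (b x w * b x w) * (A' - A)) <= m * m * dl).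
    { rewrite !Rabs_mult, (Rabs_pos_eq (/ 2)) by lra.
      assert (Rabs (b x w) * Rabs (b x w) <= m * m)
        by (apply Rmult_le_compat; auto using Rabs_pos).
      pose proof (Rabs_pos (b x w)).
      apply Rmult_le_compat; auto using Rabs_pos; try lra; nra. }
    assert (E3 : Rabs ((a x' w - a x w) * p') <= L * dl * (Rabs p + 1)).
    { rewrite Rabs_mult. apply Rmult_le_compat; auto using Rabs_pos. }
    assert (E4 : Rabs (a x w * (p' - p)) <= m * dl).
    { rewrite Rabs_mult. apply Rmult_le_compat; auto using Rabs_pos; lra. }
    assert (E : Rabs (/ 2 * ((b x' w - b x w) * (b x' w + b x w)) * A' + / 2 * (b x w * b x w) * (A' - A)
       + ((a x' w - a x w) * p' + a x w * (p' - p))) <= dl * k).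
    { eapply Rle_trans; [apply Rabs_triang|].
      eapply Rle_trans; [apply Rplus_le_compat; apply Rabs_triang|].
      unfold k. lra. }
    lra. }
  apply Rabs_le. split.
  - destruct (Ham_approx T a b f L M t x p A (eps / 2) Hi HB Ht) as [w Hw]; [lra|].
    pose proof (Ham_ub T a b f L M t' x' p' A' w HB Ht').
    specialize (Hterm w). apply Rabs_le_bounds in Hterm. lra.
  - destruct (Ham_approx T a b f L M t' x' p' A' (eps / 2) Hi HB Ht') as [w Hw]; [lra|].
    pose proof (Ham_ub T a b f L M t x p A w HB Ht).
    specialize (Hterm w). apply Rabs_le_bounds in Hterm. lra.
Qed.

(** * Semicontinuous envelopes and quadratic test functions *)

Lemma near7_refl (T delta t x r q p A l : R) :
  0 < delta -> 0 <= t <= T -> near7 T delta t x r q p A l t x r q p A l.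
Proof.
  intros Hd Ht. unfold near7. rewrite !Rminus_diag, Rabs_R0. tauto.
Qed.

Lemma lower_env_ge (T : R) (F : R -> R -> R -> R -> R -> R -> R -> R)
  (t x r q p A l e : R) :
  0 <= t <= T ->
  (exists delta, 0 < delta /\
    forall t' x' r' q' p' A' l', near7 T delta t x r q p A l t' x' r' q' p' A' l' ->
      e <= F t' x' r' q' p' A' l') ->
  e <= lower_env T F t x r q p A l.
Proof.
  intros Ht He. unfold lower_env. apply (Rsup_ub _ (F t x r q p A l)); auto.
  intros v [delta [Hd Hv]]. apply Hv. now apply near7_refl.
Qed.

Lemma upper_env_le (T : R) (F : R -> R -> R -> R -> R -> R -> R -> R)
  (t x r q p A l e : R) :
  0 <= t <= T ->
  (exists delta, 0 < delta /\
    forall t' x' r' q' p' A' l', near7 T delta t x r q p A l t' x' r' q' p' A' l' ->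
      F t' x' r' q' p' A' l' <= e) ->
  upper_env T F t x r q p A l <= e.
Proof.
  intros Ht [delta [Hd He]]. unfold upper_env, Rinf.
  match goal with |- - Rsup ?E <= _ => assert (H : - e <= Rsup E); [|lra] end.
  apply (Rsup_ub _ (- F t x r q p A l)).
  - intros v [delta' [Hd' Hv]].
    specialize (Hv t x r q p A l (near7_refl _ _ _ _ _ _ _ _ _ Hd' Ht)). lra.
  - exists delta; split; auto. intros. rewrite Ropp_involutive. now apply He.
Qed.

(** If all alternatives fail, they fail with a margin, and continuity of [Ham] and [g] keeps the
    operator at least [e] on a neighbourhood. The parabolic alternative survives at [t = T] because
    times below [T] enter the envelope there; this is the relaxed terminal condition. *)
Lemma lower_env_cases {W : Type} (dW : W -> W -> R) (T : R)
  (a b : R -> W -> R) (f : R -> R -> W -> R) (g : R -> R) (L M t x r q p A l : R) :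
  inhabited W -> compact_set dW (fun _ => True) -> is_metric dW -> cont_TRX dW T f ->
  coef_bounds T a b f L M -> continuity g -> 0 <= t <= T ->
  lower_env T (Fop T a b f g) t x r q p A l <= 0 ->
  r <= l \/ (0 <= q + Ham a b f t x p A) \/ (t = T /\ r <= g x).
Proof.
  intros Hi HW Hd Hf HB Hg Ht Henv. apply NNPP; intro Hn.
  assert (H1 : l < r) by (apply Rnot_le_lt; tauto).
  assert (H2 : q + Ham a b f t x p A < 0) by (apply Rnot_le_lt; tauto).
  assert (H3 : exists e0, 0 < e0 /\ (t = T -> g x + e0 < r)).
  { destruct (Req_dec t T) as [E|E].
    - assert (g x < r) by (apply Rnot_le_lt; tauto). exists ((r - g x) / 2); split; lra.
    - exists 1; split; lra. }
  destruct H3 as [e0 [He0 H3]].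
  set (e := Rmin (Rmin ((r - l) / 4) (- (q + Ham a b f t x p A) / 4)) (e0 / 4)).
  assert (He : 0 < e) by (repeat apply Rmin_glb_lt; lra).
  assert (E1 : e <= (r - l) / 4)
    by (eapply Rle_trans; [apply Rmin_l|apply Rmin_l]).
  assert (E2 : e <= - (q + Ham a b f t x p A) / 4)
    by (eapply Rle_trans; [apply Rmin_l|apply Rmin_r]).
  assert (E3 : e <= e0 / 4) by apply Rmin_r.
  destruct (Ham_cont dW T a b f L M t x p A e Hi HW Hd Hf HB Ht He) as [dh [Hdh Hh]].
  destruct (Hg x e He) as [dg [Hdg Hgc]].
  (* For [t < T] this radius keeps all nearby times below [T], so the terminal branch of [Fop] is
     met only if [t = T]. *)
  assert (Hdt : exists dt, 0 < dt /\ (t <> T -> t + dt <= T)).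
  { destruct (Req_dec t T) as [E|E]; [exists 1; split; lra|].
    exists (T - t); split; lra. }
  destruct Hdt as [dt [Hdt0 Hdt]].
  assert (H : e <= lower_env T (Fop T a b f g) t x r q p A l); [|lra].
  apply lower_env_ge; auto.
  exists (Rmin (Rmin dh dg) (Rmin dt e)). assert (Hdl0 : 0 < Rmin (Rmin dh dg) (Rmin dt e)) by (repeat apply Rmin_glb_lt; lra). split; [exact Hdl0|].
  set (dl := Rmin (Rmin dh dg) (Rmin dt e)).
  assert (D1 : dl <= dh) by (eapply Rle_trans; [apply Rmin_l|apply Rmin_l]).
  assert (D2 : dl <= dg) by (eapply Rle_trans; [apply Rmin_l|apply Rmin_r]).
  assert (D3 : dl <= dt) by (eapply Rle_trans; [apply Rmin_r|apply Rmin_l]).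
  assert (D4 : dl <= e) by (eapply Rle_trans; [apply Rmin_r|apply Rmin_r]).
  intros t' x' r' q' p' A' l' (N0 & N1 & N2 & N3 & N4 & N5 & N6 & N7).
  assert (Hham := Hh t' x' p' A' N0 ltac:(lra) ltac:(lra) ltac:(lra) ltac:(lra)).
  apply Rabs_le_bounds in Hham.
  apply Rabs_def2 in N1. apply Rabs_def2 in N3. apply Rabs_def2 in N4.
  apply Rabs_def2 in N7.
  unfold Fop. destruct (Rlt_dec t' T) as [Hlt|Hge]; apply Rmin_glb; try lra.
  assert (t = T) by (destruct (Req_dec t T); auto; specialize (Hdt H); lra).
  specialize (H3 H).
  assert (Rabs (g x' - g x) < e).
  { destruct (Req_dec x' x) as [->|Hne]; [rewrite Rminus_diag, Rabs_R0; auto|].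
    apply Hgc. split; [split; [exact I|auto]|]. simpl. unfold Rdist. lra. }
  apply Rabs_def2 in H0. lra.
Qed.

(** The obstacle term [r - l] occurs in the minimum of both branches, hence its sign follows at
    every time. Only the other term of the minimum depends on the branch, which gives a disjunction
    at [t = T]. *)
Lemma upper_env_cases {W : Type} (dW : W -> W -> R) (T : R)
  (a b : R -> W -> R) (f : R -> R -> W -> R) (g : R -> R) (L M t x r q p A l : R) :
  inhabited W -> compact_set dW (fun _ => True) -> is_metric dW -> cont_TRX dW T f ->
  coef_bounds T a b f L M -> continuity g -> 0 <= t <= T ->
  0 <= upper_env T (Fop T a b f g) t x r q p A l ->
  l <= r /\ (q + Ham a b f t x p A <= 0 \/ (t = T /\ g x <= r)).
Proof.
  intros Hi HW Hd Hf HB Hg Ht Henv.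
  split.
  - apply Rnot_lt_le; intro Hlt.
    assert (H : upper_env T (Fop T a b f g) t x r q p A l <= - ((l - r) / 2)); [|lra].
    apply upper_env_le; auto. exists ((l - r) / 4). split; [lra|].
    intros t' x' r' q' p' A' l' (N0 & N1 & N2 & N3 & N4 & N5 & N6 & N7).
    apply Rabs_def2 in N3. apply Rabs_def2 in N7.
    unfold Fop. destruct (Rlt_dec t' T); (eapply Rle_trans; [apply Rmin_r|lra]).
  - apply NNPP; intro Hn.
    assert (H2 : 0 < q + Ham a b f t x p A) by (apply Rnot_le_lt; tauto).
    assert (H3 : exists e0, 0 < e0 /\ (t = T -> r + e0 < g x)).
    { destruct (Req_dec t T) as [E|E].
      - assert (r < g x) by (apply Rnot_le_lt; tauto). exists ((g x - r) / 2); split; lra.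
      - exists 1; split; lra. }
    destruct H3 as [e0 [He0 H3]].
    set (e := Rmin ((q + Ham a b f t x p A) / 4) (e0 / 4)).
    assert (He : 0 < e) by (repeat apply Rmin_glb_lt; lra).
    assert (E2 : e <= (q + Ham a b f t x p A) / 4) by apply Rmin_l.
    assert (E3 : e <= e0 / 4) by apply Rmin_r.
    destruct (Ham_cont dW T a b f L M t x p A e Hi HW Hd Hf HB Ht He) as [dh [Hdh Hh]].
    destruct (Hg x e He) as [dg [Hdg Hgc]].
    assert (Hdt : exists dt, 0 < dt /\ (t <> T -> t + dt <= T)).
    { destruct (Req_dec t T) as [E|E]; [exists 1; split; lra|].
      exists (T - t); split; lra. }
    destruct Hdt as [dt [Hdt0 Hdt]].
    assert (H : upper_env T (Fop T a b f g) t x r q p A l <= - e); [|lra].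
    apply upper_env_le; auto.
    exists (Rmin (Rmin dh dg) (Rmin dt e)). assert (Hdl0 : 0 < Rmin (Rmin dh dg) (Rmin dt e)) by (repeat apply Rmin_glb_lt; lra). split; [exact Hdl0|].
    set (dl := Rmin (Rmin dh dg) (Rmin dt e)).
    assert (D1 : dl <= dh) by (eapply Rle_trans; [apply Rmin_l|apply Rmin_l]).
    assert (D2 : dl <= dg) by (eapply Rle_trans; [apply Rmin_l|apply Rmin_r]).
    assert (D3 : dl <= dt) by (eapply Rle_trans; [apply Rmin_r|apply Rmin_l]).
    assert (D4 : dl <= e) by (eapply Rle_trans; [apply Rmin_r|apply Rmin_r]).
    intros t' x' r' q' p' A' l' (N0 & N1 & N2 & N3 & N4 & N5 & N6 & N7).
    assert (Hham := Hh t' x' p' A' N0 ltac:(lra) ltac:(lra) ltac:(lra) ltac:(lra)).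
    apply Rabs_le_bounds in Hham.
    apply Rabs_def2 in N1. apply Rabs_def2 in N3. apply Rabs_def2 in N4.
    unfold Fop. destruct (Rlt_dec t' T) as [Hlt|Hge]; (eapply Rle_trans; [apply Rmin_l|]);
      try lra.
    assert (t = T) by (destruct (Req_dec t T); auto; specialize (Hdt H); lra).
    specialize (H3 H).
    assert (Rabs (g x' - g x) < e).
    { destruct (Req_dec x' x) as [->|Hne]; [rewrite Rminus_diag, Rabs_R0; auto|].
      apply Hgc. split; [split; [exact I|auto]|]. simpl. unfold Rdist. lra. }
    apply Rabs_def2 in H0. lra.
Qed.

(** * Quadratic test functions and parabolic jets *)

Lemma cont2_separable (h1 h2 : R -> R) :
  continuity h1 -> continuity h2 ->
  cont2_on (fun _ _ => True) (fun s y => h1 s + h2 y).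
Proof.
  intros H1 H2 t x _ eps He.
  assert (Hc : forall h z, continuity h -> exists d, 0 < d /\
    forall z', Rabs (z' - z) < d -> Rabs (h z' - h z) < eps / 2).
  { intros h z Hh. destruct (Hh z (eps / 2)) as [d [Hd H]]; [lra|].
    exists d; split; auto. intros z' Hz.
    destruct (Req_dec z' z) as [->|Hne]; [rewrite Rminus_diag, Rabs_R0; lra|].
    apply H. split; [split; [exact I|auto]|]. exact Hz. }
  destruct (Hc h1 t H1) as [d1 [Hd1 E1]]. destruct (Hc h2 x H2) as [d2 [Hd2 E2]].
  exists (Rmin d1 d2); split; [now apply Rmin_glb_lt|].
  intros s y _ Hs Hy.
  specialize (E1 s (Rlt_le_trans _ _ _ Hs (Rmin_l _ _))).
  specialize (E2 y (Rlt_le_trans _ _ _ Hy (Rmin_r _ _))).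
  apply Rabs_def2 in E1. apply Rabs_def2 in E2. apply Rabs_def1; lra.
Qed.

(** The summands 0 keep each function in the form [h1 s + h2 y], to which [cont2_separable]
    applies. *)
Lemma quadratic_C12 (t x q n p A : R) :
  C12_on (fun _ _ => True)
    (fun s y => (q * (s - t) + n * (s - t) ^ 2) + (p * (y - x) + A / 2 * (y - x) ^ 2))
    (fun s y => (q + 2 * n * (s - t)) + 0)
    (fun s y => 0 + (p + A * (y - x)))
    (fun s y => 0 + A).
Proof.
  assert (Hlin : forall c e z0, continuity (fun z => c + e * (z - z0))) by (intros; reg).
  assert (Hquad : forall c e z0, continuity (fun z => c * (z - z0) + e * (z - z0) ^ 2))
    by (intros; reg).
  assert (Hcst : forall c : R, continuity (fun _ => c)) by (intros; reg).
  assert (Hdquad : forall c e z0 k z, derivable_pt_lim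
    (fun z => k + (c * (z - z0) + e * (z - z0) ^ 2)) z (c + 2 * e * (z - z0))).
  { intros c e z0 k z.
    intros eps He. destruct (Req_dec e 0) as [->|Hne].
    - exists (mkposreal 1 Rlt_0_1). intros h Hh _.
      replace ((k + (c * (z + h - z0) + 0 * (z + h - z0) ^ 2) -
        (k + (c * (z - z0) + 0 * (z - z0) ^ 2))) / h - (c + 2 * 0 * (z - z0)))
        with 0 by (field; auto). now rewrite Rabs_R0.
    - assert (Hp : 0 < eps / Rabs e) by (apply Rdiv_lt_0_compat; auto using Rabs_pos_lt).
      exists (mkposreal _ Hp). simpl. intros h Hh Hh2.
      replace ((k + (c * (z + h - z0) + e * ((z + h - z0) * ((z + h - z0) * 1))) -
        (k + (c * (z - z0) + e * ((z - z0) * ((z - z0) * 1))))) / h - (c + 2 * e * (z - z0)))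
        with (e * h) by (field; auto).
      rewrite Rabs_mult.
      replace eps with (Rabs e * (eps / Rabs e)) by (field; now apply Rabs_no_R0).
      apply Rmult_lt_compat_l; auto using Rabs_pos_lt. }
  split; [intros s y _; exists 1; split; auto; lra|].
  split; [|split; [|split; [|split]]]; try now apply cont2_separable.
  intros s y _. split; [|split].
  - replace (q + 2 * n * (s - t) + 0) with (q + 2 * n * (s - t)) by ring.
    apply (derivable_pt_lim_ext
      (fun z => (p * (y - x) + A / 2 * (y - x) ^ 2) + (q * (z - t) + n * (z - t) ^ 2)));
      [intros; ring|apply Hdquad].
  - replace (0 + (p + A * (y - x))) with (p + 2 * (A / 2) * (y - x)) by field.
    apply (derivable_pt_lim_ext
      (fun z => (q * (s - t) + n * (s - t) ^ 2) + (p * (z - x) + A / 2 * (z - x) ^ 2)));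
      [intros; ring|apply Hdquad].
  - replace (0 + A) with (A + 2 * 0 * (y - x)) by ring.
    apply (derivable_pt_lim_ext (fun z => p + (A * (z - x) + 0 * (z - x) ^ 2)));
      [intros; ring|apply Hdquad].
Qed.

(* The coefficient [n] is free because the equation only sees the first time derivative. *)
Definition quad_above (D : R -> R -> Prop) (u : R -> R -> R) (t x q p A : R) : Prop :=
  exists n delta, 0 < delta /\ forall s y, D s y ->
    Rabs (s - t) < delta -> Rabs (y - x) < delta ->
    u s y <= u t x + q * (s - t) + n * (s - t) ^ 2 + p * (y - x) + A / 2 * (y - x) ^ 2.

Definition strip (T : R) : R -> R -> Prop := fun s _ => 0 <= s <= T.

(** From here on the definition of a solution enters only through this lemma, its counterpart for
    supersolutions and semicontinuity; the envelopes do not reappear. *)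
Lemma visc_sub_quad {W Y : Type} (dW : W -> W -> R) (T : R)
  (a b : R -> W -> R) (f : R -> R -> W -> R) (g : R -> R)
  (Z : R -> R -> Y -> Prop) (Gam K : R -> R -> Y -> R) (U : R -> R -> R)
  (L M t x q p A : R) :
  inhabited W -> compact_set dW (fun _ => True) -> is_metric dW -> cont_TRX dW T f ->
  coef_bounds T a b f L M -> continuity g -> 0 <= t <= T ->
  visc_sub T a b f g Z Gam K U ->
  quad_above (strip T) U t x q p A ->
  U t x <= Mop Z Gam K U t x \/ 0 <= q + Ham a b f t x p A \/ (t = T /\ U t x <= g x).
Proof.
  intros Hi HW Hd Hf HB Hg Ht [_ HU] [n [dl [Hdl Hq]]].
  specialize (HU _ _ _ _ _ (quadratic_C12 t x q n p A)).
  specialize (HU (fun _ _ _ => I) t x Ht). cbv beta in HU.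
  replace (q + 2 * n * (t - t) + 0) with q in HU by ring.
  replace (0 + (p + A * (x - x))) with p in HU by ring.
  replace (0 + A) with A in HU by ring.
  apply (lower_env_cases dW T a b f g L M t x _ q p A); auto.
  apply HU. exists dl; split; auto. intros s y Hs H1 H2.
  specialize (Hq s y Hs H1 H2). rewrite !Rminus_diag. lra.
Qed.

(** Lower jets of [V] are written as upper jets of [- V], so that the maximum and sum lemmas for
    upper semicontinuous functions serve both sides. *)
Lemma visc_super_quad {W Y : Type} (dW : W -> W -> R) (T : R)
  (a b : R -> W -> R) (f : R -> R -> W -> R) (g : R -> R)
  (Z : R -> R -> Y -> Prop) (Gam K : R -> R -> Y -> R) (V : R -> R -> R)
  (L M t x q p A : R) :
  inhabited W -> compact_set dW (fun _ => True) -> is_metric dW -> cont_TRX dW T f ->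
  coef_bounds T a b f L M -> continuity g -> 0 <= t <= T ->
  visc_super T a b f g Z Gam K V ->
  quad_above (strip T) (fun s y => - V s y) t x (- q) (- p) (- A) ->
  Mop Z Gam K V t x <= V t x /\
  (q + Ham a b f t x p A <= 0 \/ (t = T /\ g x <= V t x)).
Proof.
  intros Hi HW Hd Hf HB Hg Ht [_ HV] [n [dl [Hdl Hq]]].
  specialize (HV _ _ _ _ _ (quadratic_C12 t x q (- n) p A)).
  specialize (HV (fun _ _ _ => I) t x Ht). cbv beta in HV.
  replace (q + 2 * (- n) * (t - t) + 0) with q in HV by ring.
  replace (0 + (p + A * (x - x))) with p in HV by ring.
  replace (0 + A) with A in HV by ring.
  apply (upper_env_cases dW T a b f g L M t x _ q p A); auto.
  apply HV. exists dl; split; auto. intros s y Hs H1 H2.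
  specialize (Hq s y Hs H1 H2). rewrite !Rminus_diag. lra.
Qed.

(** * The intervention operator *)

Record impulse_data {Y : Type} (T : R) (dY : Y -> Y -> R) (Z : R -> R -> Y -> Prop)
  (Gam K : R -> R -> Y -> R) (c : R) : Prop := {
  im_metric : is_metric dY;
  im_ne : forall t x, 0 <= t <= T -> exists z, Z t x z;
  im_compact : forall t x, 0 <= t <= T -> compact_set dY (Z t x);
  im_cont : hausdorff_continuous dY T Z;
  im_Gam : cont_TRX dY T Gam;
  im_K : cont_TRX dY T K;
  im_neg : forall t x z, 0 <= t <= T -> Z t x z -> K t x z <= c }.

Lemma Mop_ge {Y : Type} (Z : R -> R -> Y -> Prop) (Gam K : R -> R -> Y -> R)
  (T : R) (dY : Y -> Y -> R) (c m t x : R) (U : R -> R -> R) (z : Y) :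
  impulse_data T dY Z Gam K c -> 0 <= t <= T ->
  (forall s y, 0 <= s <= T -> U s y <= m) ->
  Z t x z -> U t (Gam t x z) + K t x z <= Mop Z Gam K U t x.
Proof.
  intros HI Ht Hm Hz. unfold Mop. apply (Rsup_ub _ (m + c)); [|now exists z].
  intros v [z' [Hz' ->]]. pose proof (im_neg _ _ _ _ _ _ HI t x z' Ht Hz').
  specialize (Hm t (Gam t x z') Ht). lra.
Qed.

Lemma Mop_le {Y : Type} (Z : R -> R -> Y -> Prop) (Gam K : R -> R -> Y -> R)
  (T : R) (dY : Y -> Y -> R) (c m t x : R) (U : R -> R -> R) :
  impulse_data T dY Z Gam K c -> 0 <= t <= T ->
  (forall z, Z t x z -> U t (Gam t x z) + K t x z <= m) ->
  Mop Z Gam K U t x <= m.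
Proof.
  intros HI Ht Hm. unfold Mop. apply Rsup_le.
  - destruct (im_ne _ _ _ _ _ _ HI t x Ht) as [z Hz]. eexists; now exists z.
  - intros v [z [Hz ->]]. auto.
Qed.

Lemma Mop_approx {Y : Type} (Z : R -> R -> Y -> Prop) (Gam K : R -> R -> Y -> R)
  (T : R) (dY : Y -> Y -> R) (c m t x eps : R) (U : R -> R -> R) :
  impulse_data T dY Z Gam K c -> 0 <= t <= T -> 0 < eps ->
  (forall s y, 0 <= s <= T -> U s y <= m) ->
  exists z, Z t x z /\ Mop Z Gam K U t x - eps < U t (Gam t x z) + K t x z.
Proof.
  intros HI Ht He Hm.
  destruct (Rsup_approx (fun v => exists z, Z t x z /\ v = U t (Gam t x z) + K t x z)
    (m + c) eps) as [v [[z [Hz ->]] Hv]]; auto.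
  - destruct (im_ne _ _ _ _ _ _ HI t x Ht) as [z Hz]. eexists; now exists z.
  - intros v [z' [Hz' ->]]. pose proof (im_neg _ _ _ _ _ _ HI t x z' Ht Hz').
    specialize (Hm t (Gam t x z') Ht). lra.
  - now exists z.
Qed.

(** Compactness of [Z t x] makes the local bounds on [U] and [K] uniform in the impulse, and the
    first half of the Hausdorff distance brings every impulse of [Z s y] close to one of [Z t x]. *)
Lemma Mop_usc {Y : Type} (Z : R -> R -> Y -> Prop) (Gam K : R -> R -> Y -> R)
  (T : R) (dY : Y -> Y -> R) (c m : R) (U : R -> R -> R) :
  impulse_data T dY Z Gam K c ->
  (forall s y, 0 <= s <= T -> U s y <= m) ->
  usc_on T U -> usc_on T (Mop Z Gam K U).
Proof.
  intros HI Hm HU t x Ht eps He.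
  destruct (im_metric _ _ _ _ _ _ HI) as [Hd0 [Hdeq [Hsym Htri]]].
  destruct (compact_uniform dY (Z t x) (fun e z => forall s y z', 0 <= s <= T ->
     Rabs (s - t) < e -> Rabs (y - x) < e -> dY z z' < e ->
     U s (Gam s y z') + K s y z' <= Mop Z Gam K U t x + eps / 2)
     (im_compact _ _ _ _ _ _ HI t x Ht)) as [dl [Hdl H]].
  { intros e e' z Hee Hq s y z' Hs H1 H2 H3. apply Hq; auto; lra. }
  { intros z Hz. pose proof (Mop_ge Z Gam K T dY c m t x U z HI Ht Hm Hz) as Hge.
    destruct (HU t (Gam t x z) Ht (eps / 4)) as [d1 [Hd1 H1]]; [lra|].
    destruct (im_Gam _ _ _ _ _ _ HI t x z Ht d1 Hd1) as [d2 [Hd2 H2]].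
    destruct (im_K _ _ _ _ _ _ HI t x z Ht (eps / 4)) as [d3 [Hd3 H3]]; [lra|].
    set (d := Rmin d1 (Rmin d2 d3)).
    assert (Hd : 0 < d) by (repeat apply Rmin_glb_lt; auto).
    assert (E1 : d <= d1) by apply Rmin_l.
    assert (E2 : d <= d2) by (eapply Rle_trans; [apply Rmin_r|apply Rmin_l]).
    assert (E3 : d <= d3) by (eapply Rle_trans; [apply Rmin_r|apply Rmin_r]).
    exists (d / 2); split; [lra|].
    intros z1 Hz1 Hdz s y z' Hs Hst Hyx Hz'.
    assert (Hzz : dY z z' < d).
    { specialize (Htri z z1 z'). rewrite (Hsym z1 z) in Hdz. lra. }
    specialize (H2 s y z' Hs ltac:(lra) ltac:(lra) ltac:(lra)).
    specialize (H1 s (Gam s y z') Hs ltac:(lra) H2).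
    specialize (H3 s y z' Hs ltac:(lra) ltac:(lra) ltac:(lra)).
    apply Rabs_def2 in H3. lra. }
  destruct (im_cont _ _ _ _ _ _ HI t x Ht dl Hdl) as [dh [Hdh Hh]].
  exists (Rmin dl dh); split; [now apply Rmin_glb_lt|].
  intros s y Hs Hst Hyx.
  assert (Hst1 := Rlt_le_trans _ _ _ Hst (Rmin_l _ _)).
  assert (Hst2 := Rlt_le_trans _ _ _ Hst (Rmin_r _ _)).
  assert (Hyx1 := Rlt_le_trans _ _ _ Hyx (Rmin_l _ _)).
  assert (Hyx2 := Rlt_le_trans _ _ _ Hyx (Rmin_r _ _)).
  specialize (Hh s y Hs Hst2 Hyx2). unfold hausdorff_dist in Hh.
  apply Rle_lt_trans with (Mop Z Gam K U t x + eps / 2); [|lra].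
  apply (Mop_le Z Gam K T dY c); auto. intros z' Hz'.
  destruct (hausdorff_near dY (Z s y) (Z t x) dl (im_metric _ _ _ _ _ _ HI)
     (im_compact _ _ _ _ _ _ HI s y Hs) (ex_intro _ z' Hz')
     (im_ne _ _ _ _ _ _ HI t x Ht) (Rle_lt_trans _ _ _ (Rmax_l _ _) Hh) z' Hz')
    as [z [Hz Hzz]].
  apply (H z Hz); auto. now rewrite Hsym.
Qed.

(** Here a single nearly optimal impulse at [(t, x)] is enough: the second half of the Hausdorff
    distance supplies an impulse of [Z s y] close to it. *)
Lemma Mop_lsc {Y : Type} (Z : R -> R -> Y -> Prop) (Gam K : R -> R -> Y -> R)
  (T : R) (dY : Y -> Y -> R) (c m : R) (V : R -> R -> R) :
  impulse_data T dY Z Gam K c ->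
  (forall s y, 0 <= s <= T -> V s y <= m) ->
  lsc_on T V -> lsc_on T (Mop Z Gam K V).
Proof.
  intros HI Hm HV t x Ht eps He.
  destruct (Mop_approx Z Gam K T dY c m t x (eps / 4) V HI Ht) as [z [Hz Hzm]]; auto; [lra|].
  destruct (HV t (Gam t x z) Ht (eps / 4)) as [d1 [Hd1 H1]]; [lra|].
  destruct (im_Gam _ _ _ _ _ _ HI t x z Ht d1 Hd1) as [d2 [Hd2 H2]].
  destruct (im_K _ _ _ _ _ _ HI t x z Ht (eps / 4)) as [d3 [Hd3 H3]]; [lra|].
  set (d := Rmin d1 (Rmin d2 d3)).
  assert (Hd : 0 < d) by (repeat apply Rmin_glb_lt; auto).
  assert (E1 : d <= d1) by apply Rmin_l.
  assert (E2 : d <= d2) by (eapply Rle_trans; [apply Rmin_r|apply Rmin_l]).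
  assert (E3 : d <= d3) by (eapply Rle_trans; [apply Rmin_r|apply Rmin_r]).
  destruct (im_cont _ _ _ _ _ _ HI t x Ht d Hd) as [dh [Hdh Hh]].
  exists (Rmin d dh); split; [now apply Rmin_glb_lt|].
  intros s y Hs Hst Hyx.
  assert (Hst1 := Rlt_le_trans _ _ _ Hst (Rmin_l _ _)).
  assert (Hst2 := Rlt_le_trans _ _ _ Hst (Rmin_r _ _)).
  assert (Hyx1 := Rlt_le_trans _ _ _ Hyx (Rmin_l _ _)).
  assert (Hyx2 := Rlt_le_trans _ _ _ Hyx (Rmin_r _ _)).
  specialize (Hh s y Hs Hst2 Hyx2). unfold hausdorff_dist in Hh.
  destruct (hausdorff_near dY (Z t x) (Z s y) d (im_metric _ _ _ _ _ _ HI)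
     (im_compact _ _ _ _ _ _ HI t x Ht) (ex_intro _ z Hz)
     (im_ne _ _ _ _ _ _ HI s y Hs) (Rle_lt_trans _ _ _ (Rmax_r _ _) Hh) z Hz)
    as [z' [Hz' Hzz]].
  pose proof (Mop_ge Z Gam K T dY c m s y V z' HI Hs Hm Hz').
  specialize (H2 s y z' Hs ltac:(lra) ltac:(lra) ltac:(lra)).
  specialize (H1 s (Gam s y z') Hs ltac:(lra) H2).
  specialize (H3 s y z' Hs ltac:(lra) ltac:(lra) ltac:(lra)).
  apply Rabs_def2 in H3. lra.
Qed.

(** * Touching points of penalized functions *)

Lemma usc_on_strip (T : R) (u : R -> R -> R) (lo hi xlo xhi : R) :
  usc_on T u -> 0 <= lo -> hi <= T ->
  usc_within (dprod Rdist Rdist)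
    (fun P => lo <= fst P <= hi /\ xlo <= snd P <= xhi) (fun P => u (fst P) (snd P)).
Proof.
  intros Hu Hlo Hhi [t x] [Ht Hx] eps He. simpl in *.
  destruct (Hu t x ltac:(lra) eps He) as [d [Hd H]].
  exists d; split; auto. intros [s y] [Hs Hy] Hdist. simpl in *.
  apply H; [lra| |].
  - eapply Rle_lt_trans; [apply Rmax_l|exact Hdist].
  - eapply Rle_lt_trans; [apply Rmax_r|exact Hdist].
Qed.

(* The perturbation [th] is free so that it can be a parabola around an interior time or a
   steep line at the terminal time. *)
Lemma penalized_max (T : R) (u : R -> R -> R) (B tb xb n d : R) (th : R -> R) :
  usc_on T u -> (forall s y, 0 <= s <= T -> Rabs (u s y) <= B) ->
  continuity th -> (forall s, 0 <= s <= T -> 0 <= th s) ->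
  0 <= tb <= T -> th tb = 0 -> 0 < d -> 0 < n -> 2 * B < n * d ^ 2 ->
  exists s y, 0 <= s <= T /\ Rabs (y - xb) < d /\ th s <= 2 * B /\ u tb xb <= u s y /\
    forall s' y', 0 <= s' <= T -> Rabs (y' - xb) < d ->
      u s' y' - n * (y' - xb) ^ 2 - th s' <= u s y - n * (y - xb) ^ 2 - th s.
Proof.
  intros Hu HB Hth Hth0 Htb Hthb Hd Hn Hnd.
  set (A := fun P : R * R => 0 <= fst P <= T /\ xb - d <= snd P <= xb + d).
  destruct (usc_max (dprod Rdist Rdist) A
    (fun P => u (fst P) (snd P) + (th (fst P) * (-1) +
       (n * (-1)) * ((snd P + - xb) * (snd P + - xb))))) as [[s y] [HP Hmax]].
  - apply (compact_prod Rdist Rdist (fun s => 0 <= s <= T)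
      (fun y => xb - d <= y <= xb + d)); apply compact_interval.
  - exists (tb, xb). unfold A; simpl; lra.
  - apply usc_plus; [apply (usc_on_strip T); auto; lra|]. apply cont_usc.
    assert (Cs : cont_within (dprod Rdist Rdist) A (fun P => snd P)).
    { apply (cont_snd Rdist Rdist (fun s => 0 <= s <= T)
        (fun y => xb - d <= y <= xb + d) (fun y => y)), cont_id. }
    repeat first [apply cont_plus | apply cont_mult | apply cont_cst | exact Cs].
    apply (cont_fst Rdist Rdist (fun s => 0 <= s <= T)
        (fun y => xb - d <= y <= xb + d) th).
    intros z _ eps He. destruct (Hth z eps He) as [e [He' H]].
    exists e; split; auto. intros z' _ Hz.
    destruct (Req_dec z' z) as [->|Hne]; [rewrite Rminus_diag, Rabs_R0; lra|].
    apply H. split; [split; [exact I|auto]|]. exact Hz.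
  - unfold A in *; simpl in *. destruct HP as [Hs Hy].
    assert (H0 := Hmax (tb, xb) ltac:(simpl; lra)). simpl in H0. rewrite Hthb in H0.
    assert (B1 := HB s y Hs). assert (B2 := HB tb xb Htb).
    apply Rabs_le_bounds in B1. apply Rabs_le_bounds in B2.
    assert (Hths := Hth0 s Hs).
    assert (Hn2 : 0 <= n * ((y - xb) * (y - xb))) by (apply Rmult_le_pos; [lra|apply Rle_0_sqr]).
    (* At distance [d] the penalty exceeds the oscillation [2 * B], so the maximum is interior in
       space. In time it may lie at 0 or [T], which is harmless since local maxima are taken
       relative to the strip. *)
    assert (Hyd : Rabs (y - xb) < d).
    { apply Rnot_le_lt; intro Hle.
      assert (d ^ 2 <= (y - xb) * (y - xb)).
      { replace ((y - xb) * (y - xb)) with (Rabs (y - xb) * Rabs (y - xb)).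
        - simpl; rewrite Rmult_1_r. apply Rmult_le_compat; lra.
        - rewrite <- Rabs_mult. apply Rabs_pos_eq. apply Rle_0_sqr. }
      assert (n * d ^ 2 <= n * ((y - xb) * (y - xb))) by (apply Rmult_le_compat_l; lra).
      lra. }
    exists s, y. split; [auto|]. split; [auto|]. split; [lra|]. split; [lra|].
    intros s' y' Hs' Hy'. apply Rabs_def2 in Hy'.
    assert (H1 := Hmax (s', y') ltac:(simpl; lra)). simpl in H1. lra.
Qed.

(** * Obstacle and terminal inequalities *)

Lemma lsc_on_opp (T : R) (V : R -> R -> R) :
  lsc_on T V -> usc_on T (fun s y => - V s y).
Proof.
  intros HV t x Ht eps He. destruct (HV t x Ht eps He) as [d [Hd H]].
  exists d; split; auto. intros s y Hs H1 H2. specialize (H s y Hs H1 H2). lra.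
Qed.

(** [V] may have no test function touching it at [(t, x)]. A steep paraboloid touches it at a nearby
    point where [V] is no larger, and lower semicontinuity of [Mop Z Gam K V] carries the assumed
    violation to that point. *)
Lemma super_obstacle {W Y : Type} (dW : W -> W -> R) (T : R)
  (a b : R -> W -> R) (f : R -> R -> W -> R) (g : R -> R)
  (dY : Y -> Y -> R) (Z : R -> R -> Y -> Prop) (Gam K : R -> R -> Y -> R) (V : R -> R -> R)
  (L M B c t x : R) :
  inhabited W -> compact_set dW (fun _ => True) -> is_metric dW -> cont_TRX dW T f ->
  coef_bounds T a b f L M -> continuity g -> impulse_data T dY Z Gam K c ->
  (forall s y, 0 <= s <= T -> Rabs (V s y) <= B) ->
  visc_super T a b f g Z Gam K V -> 0 <= t <= T ->
  Mop Z Gam K V t x <= V t x.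
Proof.
  intros Hi HW Hd Hf HB Hg HI HVB HV Ht.
  apply Rnot_lt_le; intro Hlt.
  assert (HVub : forall s y, 0 <= s <= T -> V s y <= B).
  { intros s y Hs. eapply Rle_trans; [apply Rle_abs|auto]. }
  destruct (Mop_lsc Z Gam K T dY c B V HI HVub (proj1 HV) t x Ht (Mop Z Gam K V t x - V t x))
    as [d [Hd0 Hlsc]]; [lra|].
  set (n := (2 * Rabs B + 1) / d ^ 2).
  assert (Hd2 : 0 < d ^ 2) by (apply pow_lt; auto).
  assert (Hn : 0 < n) by (apply Rdiv_lt_0_compat; auto; pose proof (Rabs_pos B); lra).
  assert (Hnd : 2 * B < n * d ^ 2).
  { unfold n. replace ((2 * Rabs B + 1) / d ^ 2 * d ^ 2) with (2 * Rabs B + 1) by (field; lra).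
    pose proof (Rle_abs B); lra. }
  destruct (penalized_max T (fun s y => - V s y) B t x n d (fun s => n * (s - t) ^ 2))
    as [s [y [Hs [Hy [Hths [Hle Hmax]]]]]]; auto.
  - apply lsc_on_opp, HV.
  - intros. rewrite Rabs_Ropp; auto.
  - reg.
  - intros s _. apply Rmult_le_pos; [lra|apply pow2_ge_0].
  - rewrite Rminus_diag. ring.
  - assert (Hst : Rabs (s - t) < d).
    { apply Rnot_le_lt; intro Hdl.
      assert (d ^ 2 <= (s - t) ^ 2).
      { rewrite <- (pow2_abs (s - t)). apply pow_incr; lra. }
      assert (n * d ^ 2 <= n * (s - t) ^ 2) by (apply Rmult_le_compat_l; lra). lra. }
    specialize (Hlsc s y Hs Hst Hy).
    destruct (visc_super_quad dW T a b f g Z Gam K V L M s y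
      (- (2 * n * (s - t))) (- (2 * n * (y - x))) (- (2 * n)) Hi HW Hd Hf HB Hg Hs HV)
      as [H _]; [|lra].
    exists n, (d - Rabs (y - x)). split; [lra|].
    intros s' y' Hs' _ Hy'.
    assert (Hy2 : Rabs (y' - x) < d).
    { replace (y' - x) with ((y' - y) + (y - x)) by ring.
      eapply Rle_lt_trans; [apply Rabs_triang|lra]. }
    specialize (Hmax s' y' Hs' Hy2). nra.
Qed.

(** A test function with time slope [k] above the bound of the Hamiltonian makes the parabolic
    alternative impossible. The touching point is then forced to time [T], where the terminal
    alternative contradicts continuity of [g]. *)
Lemma super_terminal {W Y : Type} (dW : W -> W -> R) (T : R)
  (a b : R -> W -> R) (f : R -> R -> W -> R) (g : R -> R)
  (Z : R -> R -> Y -> Prop) (Gam K : R -> R -> Y -> R) (V : R -> R -> R)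
  (L M B x : R) :
  0 < T ->
  inhabited W -> compact_set dW (fun _ => True) -> is_metric dW -> cont_TRX dW T f ->
  coef_bounds T a b f L M -> continuity g ->
  (forall s y, 0 <= s <= T -> Rabs (V s y) <= B) ->
  visc_super T a b f g Z Gam K V -> g x <= V T x.
Proof.
  intros HT Hi HW Hd Hf HB Hg HVB HV.
  apply Rnot_lt_le; intro Hlt.
  destruct (Hg x (g x - V T x)) as [d [Hd0 Hgc]]; [lra|].
  assert (Hgy : forall y, Rabs (y - x) < d -> V T x < g y).
  { intros y Hy. destruct (Req_dec y x) as [->|Hne]; auto.
    assert (H : Rabs (g y - g x) < g x - V T x)
      by (apply Hgc; split; [split; [exact I|auto]|exact Hy]).
    apply Rabs_def2 in H. lra. }
  set (n := (2 * Rabs B + 1) / d ^ 2).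
  assert (Hd2 : 0 < d ^ 2) by (apply pow_lt; auto).
  assert (Hn : 0 < n) by (apply Rdiv_lt_0_compat; auto; pose proof (Rabs_pos B); lra).
  assert (Hnd : 2 * B < n * d ^ 2).
  { unfold n. replace ((2 * Rabs B + 1) / d ^ 2 * d ^ 2) with (2 * Rabs B + 1) by (field; lra).
    pose proof (Rle_abs B); lra. }
  set (m := L * (1 + (Rabs x + d))).
  (* The space curvature [2 * n] and the slope, at most [2 * n * d], are fixed before [k], so [k]
     can exceed their Hamiltonian on the whole ball of radius [d]. *)
  set (k := m ^ 2 * (2 * n) + m * (2 * n * d) + M + 1).
  pose proof (cb_L _ _ _ _ _ _ HB) as HL. pose proof (cb_M _ _ _ _ _ _ HB) as HM.
  pose proof (Rabs_pos x) as Hx0.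
  assert (Hm : 0 <= m) by (apply Rmult_le_pos; lra).
  assert (Hk : 0 < k).
  { unfold k. pose proof (pow2_ge_0 m).
    assert (0 <= m ^ 2 * (2 * n)) by (apply Rmult_le_pos; lra).
    assert (0 <= m * (2 * n * d)) by (apply Rmult_le_pos; nra). lra. }
  destruct (penalized_max T (fun s y => - V s y) B T x n d (fun s => k * (T - s)))
    as [s [y [Hs [Hy [Hths [Hle Hmax]]]]]]; auto; try lra.
  - apply lsc_on_opp, HV.
  - intros. rewrite Rabs_Ropp; auto.
  - reg.
  - intros s Hs. apply Rmult_le_pos; lra.
  - destruct (visc_super_quad dW T a b f g Z Gam K V L M s y
      k (- (2 * n * (y - x))) (- (2 * n)) Hi HW Hd Hf HB Hg Hs HV)
      as [_ H].
    + exists 0, (d - Rabs (y - x)). split; [lra|].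
      intros s' y' Hs' _ Hy'.
      assert (Hy2 : Rabs (y' - x) < d).
      { replace (y' - x) with ((y' - y) + (y - x)) by ring.
        eapply Rle_lt_trans; [apply Rabs_triang|lra]. }
      specialize (Hmax s' y' Hs' Hy2). nra.
    + assert (Hham := Ham_bound T a b f L M s y (- (2 * n * (y - x))) (- (2 * n)) Hi HB Hs).
      assert (Hyb : Rabs y <= Rabs x + d).
      { replace y with ((y - x) + x) by ring. eapply Rle_trans; [apply Rabs_triang|lra]. }
      assert (Hk2 : (L * (1 + Rabs y)) ^ 2 * Rabs (- (2 * n)) +
         L * (1 + Rabs y) * Rabs (- (2 * n * (y - x))) + M <= k - 1).
      { rewrite !Rabs_Ropp, (Rabs_mult (2 * n) (y - x)), (Rabs_pos_eq (2 * n)) by lra.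
        pose proof (Rabs_pos y).
        assert (L * (1 + Rabs y) <= m) by (apply Rmult_le_compat_l; lra).
        assert (0 <= L * (1 + Rabs y)) by (apply Rmult_le_pos; lra).
        assert ((L * (1 + Rabs y)) ^ 2 * (2 * n) <= m ^ 2 * (2 * n)).
        { apply Rmult_le_compat_r; [lra|]. apply pow_incr; lra. }
        assert (L * (1 + Rabs y) * (2 * n * Rabs (y - x)) <= m * (2 * n * d)).
        { apply Rmult_le_compat; auto.
          - apply Rmult_le_pos; [lra|apply Rabs_pos].
          - apply Rmult_le_compat_l; lra. }
        unfold k. lra. }
      apply Rabs_le_bounds in Hham.
      destruct H as [H|[-> H]]; [lra|]. specialize (Hgy y Hy). lra.
Qed.

(** Same steep time slope as for the supersolution, now with sign [- k]. The impulse alternative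
    must be excluded as well, through upper semicontinuity of [Mop Z Gam K U] at [(T, x)]. *)
Lemma sub_terminal_cases {W Y : Type} (dW : W -> W -> R) (T : R)
  (a b : R -> W -> R) (f : R -> R -> W -> R) (g : R -> R)
  (dY : Y -> Y -> R) (Z : R -> R -> Y -> Prop) (Gam K : R -> R -> Y -> R) (U : R -> R -> R)
  (L M B c x : R) :
  0 < T ->
  inhabited W -> compact_set dW (fun _ => True) -> is_metric dW -> cont_TRX dW T f ->
  coef_bounds T a b f L M -> continuity g -> impulse_data T dY Z Gam K c ->
  (forall s y, 0 <= s <= T -> Rabs (U s y) <= B) ->
  visc_sub T a b f g Z Gam K U -> U T x <= g x \/ U T x <= Mop Z Gam K U T x.
Proof.
  intros HT Hi HW Hd Hf HB Hg HI HUB HU.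
  apply NNPP; intro Hcon.
  assert (Hlt1 : g x < U T x) by (apply Rnot_le_lt; tauto).
  assert (Hlt2 : Mop Z Gam K U T x < U T x) by (apply Rnot_le_lt; tauto).
  assert (HUub : forall s y, 0 <= s <= T -> U s y <= B).
  { intros s y Hs. eapply Rle_trans; [apply Rle_abs|auto]. }
  destruct (Mop_usc Z Gam K T dY c B U HI HUub (proj1 HU) T x ltac:(lra)
    (U T x - Mop Z Gam K U T x)) as [dm [Hdm Husc]]; [lra|].
  destruct (Hg x (U T x - g x)) as [dg [Hdg Hgc]]; [lra|].
  set (d := Rmin dm dg).
  assert (Hd0 : 0 < d) by (now apply Rmin_glb_lt).
  assert (Hd1 : d <= dm) by apply Rmin_l.
  assert (Hd2' : d <= dg) by apply Rmin_r.
  assert (Hgy : forall y, Rabs (y - x) < d -> g y < U T x).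
  { intros y Hy. destruct (Req_dec y x) as [->|Hne]; auto.
    assert (H : Rabs (g y - g x) < U T x - g x).
    { apply Hgc; split; [split; [exact I|auto]|]. simpl. unfold Rdist. lra. }
    apply Rabs_def2 in H. lra. }
  set (n := (2 * Rabs B + 1) / d ^ 2).
  assert (Hd2 : 0 < d ^ 2) by (apply pow_lt; auto).
  assert (Hn : 0 < n) by (apply Rdiv_lt_0_compat; auto; pose proof (Rabs_pos B); lra).
  assert (Hnd : 2 * B < n * d ^ 2).
  { unfold n. replace ((2 * Rabs B + 1) / d ^ 2 * d ^ 2) with (2 * Rabs B + 1) by (field; lra).
    pose proof (Rle_abs B); lra. }
  set (m := L * (1 + (Rabs x + d))).
  (* The last summand forces the touching time within [d] of [T], where [Mop Z Gam K U] is under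
     control. *)
  set (k := m ^ 2 * (2 * n) + m * (2 * n * d) + M + 1 + (2 * Rabs B + 1) / d).
  pose proof (cb_L _ _ _ _ _ _ HB) as HL. pose proof (cb_M _ _ _ _ _ _ HB) as HM.
  pose proof (Rabs_pos x) as Hx0.
  assert (Hm : 0 <= m) by (apply Rmult_le_pos; lra).
  assert (Hq0 : 0 < (2 * Rabs B + 1) / d)
    by (apply Rdiv_lt_0_compat; auto; pose proof (Rabs_pos B); lra).
  assert (Hk : (2 * Rabs B + 1) / d < k).
  { unfold k. pose proof (pow2_ge_0 m).
    assert (0 <= m ^ 2 * (2 * n)) by (apply Rmult_le_pos; lra).
    assert (0 <= m * (2 * n * d)) by (apply Rmult_le_pos; nra). lra. }
  destruct (penalized_max T U B T x n d (fun s => k * (T - s)))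
    as [s [y [Hs [Hy [Hths [Hle Hmax]]]]]]; auto; try lra.
  - apply HU.
  - reg.
  - intros s Hs. apply Rmult_le_pos; lra.
  - assert (HTs : Rabs (s - T) < d).
    { rewrite Rabs_minus_sym, Rabs_pos_eq by lra. apply Rnot_le_lt; intro Hge.
      assert (H1 : (2 * Rabs B + 1) / d * d <= k * (T - s)).
      { apply Rmult_le_compat; lra. }
      replace ((2 * Rabs B + 1) / d * d) with (2 * Rabs B + 1) in H1 by (field; lra).
      pose proof (Rle_abs B). lra. }
    specialize (Husc s y Hs ltac:(lra) ltac:(lra)).
    destruct (visc_sub_quad dW T a b f g Z Gam K U L M s y
      (- k) (2 * n * (y - x)) (2 * n) Hi HW Hd Hf HB Hg Hs HU) as [H|[H|[-> H]]].
    + exists 0, (d - Rabs (y - x)). split; [lra|].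
      intros s' y' Hs' _ Hy'.
      assert (Hy2 : Rabs (y' - x) < d).
      { replace (y' - x) with ((y' - y) + (y - x)) by ring.
        eapply Rle_lt_trans; [apply Rabs_triang|lra]. }
      specialize (Hmax s' y' Hs' Hy2). nra.
    + lra.
    + assert (Hham := Ham_bound T a b f L M s y (2 * n * (y - x)) (2 * n) Hi HB Hs).
      assert (Hyb : Rabs y <= Rabs x + d).
      { replace y with ((y - x) + x) by ring. eapply Rle_trans; [apply Rabs_triang|lra]. }
      assert (Hk2 : (L * (1 + Rabs y)) ^ 2 * Rabs (2 * n) +
         L * (1 + Rabs y) * Rabs (2 * n * (y - x)) + M <= k - 1 - (2 * Rabs B + 1) / d).
      { rewrite (Rabs_mult (2 * n) (y - x)), (Rabs_pos_eq (2 * n)) by lra.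
        pose proof (Rabs_pos y).
        assert (L * (1 + Rabs y) <= m) by (apply Rmult_le_compat_l; lra).
        assert (0 <= L * (1 + Rabs y)) by (apply Rmult_le_pos; lra).
        assert ((L * (1 + Rabs y)) ^ 2 * (2 * n) <= m ^ 2 * (2 * n)).
        { apply Rmult_le_compat_r; [lra|]. apply pow_incr; lra. }
        assert (L * (1 + Rabs y) * (2 * n * Rabs (y - x)) <= m * (2 * n * d)).
        { apply Rmult_le_compat; auto.
          - apply Rmult_le_pos; [lra|apply Rabs_pos].
          - apply Rmult_le_compat_l; lra. }
        unfold k. lra. }
      apply Rabs_le_bounds in Hham. lra.
    + specialize (Hgy y Hy). lra.
Qed.

(* Following an almost optimal impulse raises U by at least -c/2, so a chain of impulses
   has to reach a point where U <= g, and Mg <= g then transports the bound back. *)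
Lemma sub_terminal {W Y : Type} (dW : W -> W -> R) (T : R)
  (a b : R -> W -> R) (f : R -> R -> W -> R) (g : R -> R)
  (dY : Y -> Y -> R) (Z : R -> R -> Y -> Prop) (Gam K : R -> R -> Y -> R) (U : R -> R -> R)
  (L M B G c x : R) :
  0 < T -> c < 0 ->
  inhabited W -> compact_set dW (fun _ => True) -> is_metric dW -> cont_TRX dW T f ->
  coef_bounds T a b f L M -> continuity g -> impulse_data T dY Z Gam K c ->
  (forall s y, 0 <= s <= T -> Rabs (U s y) <= B) -> (forall y, g y <= G) ->
  (forall y, Mg T Z Gam K g y <= g y) ->
  visc_sub T a b f g Z Gam K U -> U T x <= g x.
Proof.
  intros HT Hc Hi HW Hd Hf HB Hg HI HUB HG HMg HU.
  assert (HTT : 0 <= T <= T) by lra.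
  assert (HUub : forall s y, 0 <= s <= T -> U s y <= B).
  { intros s y Hs. eapply Rle_trans; [apply Rle_abs|auto]. }
  (* [N] bounds the number of impulses still possible: for [N = 0] the premise contradicts [U <= B],
     and each impulse lifts the value by more than [- c / 2]. *)
  assert (Hind : forall (N : nat) y, B + INR N * (c / 2) < U T y -> U T y <= g y).
  { induction N as [|N IH]; intros y Hy.
    - simpl in Hy. specialize (HUub T y HTT). lra.
    - rewrite S_INR in Hy.
      destruct (sub_terminal_cases dW T a b f g dY Z Gam K U L M B c y) as [H|H]; auto.
      apply Rnot_lt_le; intro Hlt.
      (* The tolerance [- c / 2] leaves half of the gain [- c]; the tolerance [U T y - g y] makes
         the bound through [Mg] contradict [g y < U T y]. *)
      destruct (Mop_approx Z Gam K T dY c B T y (Rmin (- c / 2) (U T y - g y)) U HI HTT)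
        as [z [Hz Hzm]]; auto.
      { apply Rmin_glb_lt; lra. }
      pose proof (Rmin_l (- c / 2) (U T y - g y)).
      pose proof (Rmin_r (- c / 2) (U T y - g y)).
      pose proof (im_neg _ _ _ _ _ _ HI T y z HTT Hz).
      assert (HUg := IH (Gam T y z) ltac:(lra)).
      assert (HMg1 : g (Gam T y z) + K T y z <= Mg T Z Gam K g y).
      { unfold Mg. apply (Rsup_ub _ (G + c)); [|now exists z].
        intros v [z' [Hz' ->]]. pose proof (im_neg _ _ _ _ _ _ HI T y z' HTT Hz').
        specialize (HG (Gam T y z')). lra. }
      specialize (HMg y). lra. }
  destruct (INR_unbounded ((B - U T x) / (- c / 2))) as [N HN].
  apply (Hind N).
  assert (H : (B - U T x) / (- c / 2) * (- c / 2) < INR N * (- c / 2))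
    by (apply Rmult_lt_compat_r; lra).
  replace ((B - U T x) / (- c / 2) * (- c / 2)) with (B - U T x) in H by (field; lra).
  lra.
Qed.

(** * Sup-convolutions and the theorem on sums *)

Definition rect (lo hi xlo xhi : R) : R -> R -> Prop :=
  fun s y => lo <= s <= hi /\ xlo <= y <= xhi.

Definition usc_rect (lo hi xlo xhi : R) (u : R -> R -> R) : Prop :=
  usc_within (dprod Rdist Rdist)
    (fun P => lo <= fst P <= hi /\ xlo <= snd P <= xhi) (fun P => u (fst P) (snd P)).

Lemma compact_rect (lo hi xlo xhi : R) :
  compact_set (dprod Rdist Rdist) (fun P => lo <= fst P <= hi /\ xlo <= snd P <= xhi).
Proof.
  apply (compact_prod Rdist Rdist (fun s => lo <= s <= hi) (fun y => xlo <= y <= xhi));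
    apply compact_interval.
Qed.

Lemma cont_rect_fst (lo hi xlo xhi : R) :
  cont_within (dprod Rdist Rdist)
    (fun P => lo <= fst P <= hi /\ xlo <= snd P <= xhi) (fun P => fst P).
Proof.
  apply (cont_fst Rdist Rdist (fun s => lo <= s <= hi) (fun y => xlo <= y <= xhi)
    (fun s => s)), cont_id.
Qed.

Lemma cont_rect_snd (lo hi xlo xhi : R) :
  cont_within (dprod Rdist Rdist)
    (fun P => lo <= fst P <= hi /\ xlo <= snd P <= xhi) (fun P => snd P).
Proof.
  apply (cont_snd Rdist Rdist (fun s => lo <= s <= hi) (fun y => xlo <= y <= xhi)
    (fun s => s)), cont_id.
Qed.

(** Continuity of [G] is stated as stability under composition, so that [cont_tac] proves it
    directly from a polynomial expression. *)
Lemma rect2_max (lo hi xlo xhi lo' hi' xlo' xhi' : R) (u v : R -> R -> R)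
  (G : R -> R -> R -> R -> R) :
  usc_rect lo hi xlo xhi u -> usc_rect lo' hi' xlo' xhi' v ->
  (forall d (A : (R * R) * (R * R) -> Prop) s y t x,
     cont_within d A s -> cont_within d A y -> cont_within d A t -> cont_within d A x ->
     cont_within d A (fun P => G (s P) (y P) (t P) (x P))) ->
  (exists s y, rect lo hi xlo xhi s y) -> (exists t x, rect lo' hi' xlo' xhi' t x) ->
  exists s y t x, rect lo hi xlo xhi s y /\ rect lo' hi' xlo' xhi' t x /\
    forall s' y' t' x', rect lo hi xlo xhi s' y' -> rect lo' hi' xlo' xhi' t' x' ->
      u s' y' + v t' x' + G s' y' t' x' <= u s y + v t x + G s y t x.
Proof.
  intros Hu Hv HG [s1 [y1 H1]] [t1 [x1 H2]].
  set (A1 := fun P : R * R => lo <= fst P <= hi /\ xlo <= snd P <= xhi).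
  set (A2 := fun P : R * R => lo' <= fst P <= hi' /\ xlo' <= snd P <= xhi').
  set (d := dprod (dprod Rdist Rdist) (dprod Rdist Rdist)).
  destruct (usc_max d (fun P => A1 (fst P) /\ A2 (snd P))
    (fun P => u (fst (fst P)) (snd (fst P)) + v (fst (snd P)) (snd (snd P)) +
       G (fst (fst P)) (snd (fst P)) (fst (snd P)) (snd (snd P))))
    as [[[s y] [t x]] [[HP1 HP2] Hmax]].
  - apply compact_prod; apply compact_rect.
  - exists ((s1, y1), (t1, x1)). now split.
  - apply usc_plus; [apply usc_plus|].
    + apply (usc_fst (dprod Rdist Rdist) (dprod Rdist Rdist) A1 A2
        (fun P => u (fst P) (snd P))), Hu.
    + apply (usc_snd (dprod Rdist Rdist) (dprod Rdist Rdist) A1 A2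
        (fun P => v (fst P) (snd P))), Hv.
    + apply cont_usc, HG.
      * apply (cont_fst (dprod Rdist Rdist) (dprod Rdist Rdist) A1 A2 fst), cont_rect_fst.
      * apply (cont_fst (dprod Rdist Rdist) (dprod Rdist Rdist) A1 A2 snd), cont_rect_snd.
      * apply (cont_snd (dprod Rdist Rdist) (dprod Rdist Rdist) A1 A2 fst), cont_rect_fst.
      * apply (cont_snd (dprod Rdist Rdist) (dprod Rdist Rdist) A1 A2 snd), cont_rect_snd.
  - exists s, y, t, x. split; [exact HP1|]. split; [exact HP2|].
    intros s' y' t' x' H1' H2'.
    exact (Hmax ((s', y'), (t', x')) (conj H1' H2')).
Qed.

(** A characterization by upper bound and attainment. The base point [(t, x)] ranges over the whole
    plane, so it can be moved freely even when the maximizer lies on the boundary of [D]. *)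
Definition is_sup_conv (D : R -> R -> Prop) (u : R -> R -> R) (N : R) (uh : R -> R -> R) :=
  (forall t x s y, D s y -> u s y - N * ((s - t) ^ 2 + (y - x) ^ 2) <= uh t x) /\
  (forall t x, exists s y, D s y /\ uh t x = u s y - N * ((s - t) ^ 2 + (y - x) ^ 2)).

Lemma sup_conv_exists (lo hi xlo xhi N : R) (u : R -> R -> R) :
  lo <= hi -> xlo <= xhi -> usc_rect lo hi xlo xhi u ->
  exists uh, is_sup_conv (rect lo hi xlo xhi) u N uh.
Proof.
  intros Hlo Hx Hu.
  assert (H : forall X : R * R, exists v, exists s y, rect lo hi xlo xhi s y /\
    v = u s y - N * ((s - fst X) ^ 2 + (y - snd X) ^ 2) /\
    forall s' y', rect lo hi xlo xhi s' y' ->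
      u s' y' - N * ((s' - fst X) ^ 2 + (y' - snd X) ^ 2) <= v).
  { intros [t x]. simpl fst; simpl snd.
    destruct (usc_max _ _ (fun P => u (fst P) (snd P) +
        (- N) * ((fst P - t) ^ 2 + (snd P - x) ^ 2)) (compact_rect lo hi xlo xhi))
      as [[s y] [HP Hmax]].
    - exists (lo, xlo). simpl; lra.
    - apply usc_plus; [exact Hu|]. apply cont_usc.
      pose proof (cont_rect_fst lo hi xlo xhi). pose proof (cont_rect_snd lo hi xlo xhi).
      cont_tac.
    - exists (u s y - N * ((s - t) ^ 2 + (y - x) ^ 2)), s, y.
      split; [exact HP|]. split; [reflexivity|].
      intros s' y' H'. specialize (Hmax (s', y') H'). simpl in Hmax. simpl. lra. }
  destruct (choice _ H) as [v Hv].
  exists (fun t x => v (t, x)). split.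
  - intros t x s y HD. destruct (Hv (t, x)) as (s0 & y0 & _ & _ & Hmax). now apply Hmax.
  - intros t x. destruct (Hv (t, x)) as (s0 & y0 & HD & E & _). now exists s0, y0.
Qed.

(** The first-order condition at an interior maximum, usable without derivatives. *)
Lemma linear_le_quadratic_zero (c e d : R) :
  0 < d -> (forall h, Rabs h < d -> c * h <= e * h ^ 2) -> c = 0.
Proof.
  intros Hd H. apply NNPP; intro Hc.
  assert (Hac : 0 < Rabs c) by now apply Rabs_pos_lt.
  set (k := Rmin (d / 2) (Rabs c / (2 * (Rabs e + 1)))).
  pose proof (Rabs_pos e) as He0.
  assert (Hk : 0 < k).
  { apply Rmin_glb_lt; [lra|]. apply Rdiv_lt_0_compat; lra. }
  assert (Hk1 : k <= d / 2) by apply Rmin_l.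
  assert (Hk2 : k * (Rabs e + 1) <= Rabs c / 2).
  { replace (Rabs c / 2) with (Rabs c / (2 * (Rabs e + 1)) * (Rabs e + 1)) by (field; lra).
    apply Rmult_le_compat_r; [lra|apply Rmin_r]. }
  pose proof (Rle_abs e) as He.
  assert (H1 : Rabs c * k <= e * k ^ 2).
  { destruct (Rle_dec 0 c) as [Hp|Hp].
    - rewrite (Rabs_pos_eq c) by auto. apply H. rewrite Rabs_pos_eq; lra.
    - rewrite (Rabs_left c) by lra. specialize (H (- k)).
      rewrite Rabs_Ropp, Rabs_pos_eq in H by lra. specialize (H ltac:(lra)). lra. }
  nra.
Qed.

(** The maximizer for [(t, x)] is a competitor for [(t', x)], and its time coordinate is confined to
    [[lo, hi]]. *)
Lemma sup_conv_lipschitz_time (lo hi xlo xhi N : R) (u uh : R -> R -> R) (t t' x : R) :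
  is_sup_conv (rect lo hi xlo xhi) u N uh -> 0 <= N ->
  uh t x <= uh t' x + N * (2 * Rabs lo + 2 * Rabs hi + Rabs t + Rabs t') * Rabs (t - t').
Proof.
  intros [Hub Hat] HN. destruct (Hat t x) as (s & y & HD & ->).
  specialize (Hub t' x s y HD). destruct HD as [Hs _].
  assert (H : N * ((s - t') ^ 2 - (s - t) ^ 2) <=
     N * ((2 * Rabs lo + 2 * Rabs hi + Rabs t + Rabs t') * Rabs (t - t'))).
  { apply Rmult_le_compat_l; auto.
    replace ((s - t') ^ 2 - (s - t) ^ 2) with ((2 * s - t - t') * (t - t')) by ring.
    eapply Rle_trans; [apply Rle_abs|]. rewrite Rabs_mult.
    apply Rmult_le_compat_r; [apply Rabs_pos|].
    apply Rabs_le. pose proof (Rabs_le_bounds lo _ (Rle_refl _)).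
    pose proof (Rabs_le_bounds hi _ (Rle_refl _)). pose proof (Rabs_le_bounds t _ (Rle_refl _)).
    pose proof (Rabs_le_bounds t' _ (Rle_refl _)). lra. }
  lra.
Qed.

(* A second difference below [A tau^2] forces a parabola of curvature [A] to touch the
   slice [uh t0] from above inside the interval; the penalty [n (t - t0)^2] makes this a
   touching point in both variables, and translation moves it to the maximizer [(s, y)]. *)
Lemma sup_conv_curved_jet (lo hi xlo xhi N : R) (u uh : R -> R -> R) (t0 x0 tau A : R) :
  lo <= hi -> xlo <= xhi -> usc_rect lo hi xlo xhi u -> 0 < N ->
  is_sup_conv (rect lo hi xlo xhi) u N uh -> 0 < tau ->
  uh t0 (x0 + tau) + uh t0 (x0 - tau) - 2 * uh t0 x0 < A * tau ^ 2 ->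
  exists s y t x, rect lo hi xlo xhi s y /\ Rabs (t - t0) < tau /\ Rabs (x - x0) < tau /\
    uh t x = u s y - N * ((s - t) ^ 2 + (y - x) ^ 2) /\
    quad_above (rect lo hi xlo xhi) u s y (2 * N * (s - t)) (2 * N * (y - x)) A.
Proof.
  intros Hlo Hxx Hu HN Hsc Htau Hsd.
  (* With this slope the function [uh t0] minus the parabola takes the same value, [uh t0 x0 - gam],
     at both ends of the interval. *)
  set (m := (uh t0 (x0 + tau) - uh t0 (x0 - tau)) / (2 * tau)).
  set (gam := (A * tau ^ 2 - (uh t0 (x0 + tau) + uh t0 (x0 - tau) - 2 * uh t0 x0)) / 2).
  assert (Hgam : 0 < gam) by (unfold gam; lra).
  set (Lt := N * (2 * Rabs lo + 2 * Rabs hi + (Rabs t0 + tau) + Rabs t0) + 1).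
  assert (HLt : 0 < Lt).
  { unfold Lt. pose proof (Rabs_pos lo). pose proof (Rabs_pos hi). pose proof (Rabs_pos t0).
    assert (0 <= N * (2 * Rabs lo + 2 * Rabs hi + (Rabs t0 + tau) + Rabs t0))
      by (apply Rmult_le_pos; lra). lra. }
  assert (Hlip : forall t x, Rabs (t - t0) <= tau -> uh t x <= uh t0 x + Lt * Rabs (t - t0)).
  { intros t x Ht. eapply Rle_trans.
    - apply (sup_conv_lipschitz_time lo hi xlo xhi N u uh t t0 x Hsc); lra.
    - apply Rplus_le_compat_l, Rmult_le_compat_r; [apply Rabs_pos|].
      assert (Rabs t <= Rabs t0 + tau) by (pose proof (Rabs_triang_inv t t0); lra).
      unfold Lt. nra. }
  (* The term [Lt / tau] keeps the maximum interior in time. The term [Lt ^ 2 / gam] keeps the gain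
     [Lt * z - n * z ^ 2] of a time shift below [gam], so the space end points cannot be optimal. *)
  set (n := Lt / tau + Lt ^ 2 / gam + 1).
  assert (Hn1 : Lt < n * tau).
  { unfold n. replace ((Lt / tau + Lt ^ 2 / gam + 1) * tau)
      with (Lt + (Lt ^ 2 / gam + 1) * tau) by (field; lra).
    assert (0 < Lt ^ 2 / gam) by (apply Rdiv_lt_0_compat; auto; apply pow_lt; auto). nra. }
  assert (Hn2 : Lt ^ 2 < n * gam).
  { unfold n. replace ((Lt / tau + Lt ^ 2 / gam + 1) * gam)
      with (Lt ^ 2 + (Lt / tau + 1) * gam) by (field; lra).
    assert (0 < Lt / tau) by (apply Rdiv_lt_0_compat; auto). nra. }
  assert (Hn : 0 < n) by nra.
  set (phi := fun t x => m * (x - x0) + A / 2 * (x - x0) ^ 2 + n * (t - t0) ^ 2).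
  (* Maximizing jointly over the convolution point and the base point gives a maximum of [uh - phi]
     without any continuity of [uh]. *)
  destruct (rect2_max lo hi xlo xhi (t0 - tau) (t0 + tau) (x0 - tau) (x0 + tau) u
    (fun _ _ => 0) (fun s y t x => (- N) * ((s - t) ^ 2 + (y - x) ^ 2) -
      (m * (x - x0) + A / 2 * (x - x0) ^ 2 + n * (t - t0) ^ 2)))
    as (s & y & t & x & HD & HX & Hmax).
  - exact Hu.
  - apply cont_usc, cont_cst.
  - intros d B s y t x H1 H2 H3 H4. cont_tac.
  - exists lo, xlo. unfold rect; lra.
   - exists t0, x0. unfold rect; lra.
  - destruct Hsc as [Hub Hat]. destruct HX as [Ht Hx].
    assert (Huh : uh t x = u s y - N * ((s - t) ^ 2 + (y - x) ^ 2)).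
    { apply Rle_antisym; [|now apply Hub].
      destruct (Hat t x) as (s' & y' & HD' & ->).
      assert (H := Hmax s' y' t x HD' ltac:(split; auto)). lra. }
    assert (HmaxX : forall t' x', t0 - tau <= t' <= t0 + tau -> x0 - tau <= x' <= x0 + tau ->
      uh t' x' - phi t' x' <= uh t x - phi t x).
    { intros t' x' Ht' Hx'. destruct (Hat t' x') as (s' & y' & HD' & ->).
      assert (H := Hmax s' y' t' x' HD' ltac:(split; auto)). rewrite Huh. unfold phi. lra. }
    assert (Hcen : uh t0 x0 <= uh t x - phi t x).
    { assert (H := HmaxX t0 x0 ltac:(lra) ltac:(lra)). unfold phi in H at 1.
      rewrite !Rminus_diag in H. lra. }
    assert (Ht1 : Rabs (t - t0) <= tau) by (apply Rabs_le; lra).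
    assert (HL := Hlip t x Ht1).
    assert (Hsq : (t - t0) ^ 2 = Rabs (t - t0) ^ 2) by (now rewrite pow2_abs).
    assert (Htint : Rabs (t - t0) < tau).
    { destruct Ht1 as [|Heq]; auto. exfalso.
      assert (H := HmaxX t0 x ltac:(lra) Hx). unfold phi in H.
      rewrite Rminus_diag, Hsq in H. rewrite Heq in H, HL. nra. }
    assert (Hpar : Lt * Rabs (t - t0) - n * (t - t0) ^ 2 < gam).
    { rewrite Hsq. set (z := Rabs (t - t0)).
      assert (n * (Lt * z - n * z ^ 2) < n * gam); [|nra].
      assert (0 <= (Lt / 2 - n * z) ^ 2) by apply pow2_ge_0.
      assert (0 <= Lt ^ 2) by apply pow2_ge_0. nra. }
    assert (Hend : forall sg, sg = 1 \/ sg = -1 -> x <> x0 + sg * tau).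
    { intros sg Hsg E.
      assert (E2 : uh t0 x - (m * (x - x0) + A / 2 * (x - x0) ^ 2) = uh t0 x0 - gam).
      { rewrite E. replace (x0 + sg * tau - x0) with (sg * tau) by ring.
        unfold m, gam. destruct Hsg as [->| ->].
        - replace (x0 + 1 * tau) with (x0 + tau) by ring. field; lra.
        - replace (x0 + -1 * tau) with (x0 - tau) by ring. field; lra. }
      unfold phi in Hcen. lra. }
    assert (Hxint : Rabs (x - x0) < tau).
    { apply Rabs_def1.
      - assert (H := Hend 1 (or_introl eq_refl)). lra.
      - assert (H := Hend (-1) (or_intror eq_refl)). lra. }
    apply Rabs_def2 in Htint as Htb. apply Rabs_def2 in Hxint as Hxb.
    set (r := Rmin (tau - Rabs (t - t0)) (tau - Rabs (x - x0))).
    assert (Hr : 0 < r) by (apply Rmin_glb_lt; lra).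
    assert (Hr1 : forall h, Rabs h < r -> t0 - tau <= t + h <= t0 + tau).
    { intros h Hh. assert (r <= tau - Rabs (t - t0)) by apply Rmin_l.
      assert (Rabs (t - t0 + h) < tau) by (eapply Rle_lt_trans; [apply Rabs_triang|lra]).
      apply Rabs_def2 in H0. lra. }
    assert (Hr2 : forall h, Rabs h < r -> x0 - tau <= x + h <= x0 + tau).
    { intros h Hh. assert (r <= tau - Rabs (x - x0)) by apply Rmin_r.
      assert (Rabs (x - x0 + h) < tau) by (eapply Rle_lt_trans; [apply Rabs_triang|lra]).
      apply Rabs_def2 in H0. lra. }
    assert (Hq : 2 * N * (s - t) = 2 * n * (t - t0)).
    { assert (2 * N * (s - t) - 2 * n * (t - t0) = 0); [|lra].
      apply (linear_le_quadratic_zero _ (N + n) r Hr). intros h Hh.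
      assert (H := Hmax s y (t + h) x HD (conj (Hr1 h Hh) Hx)). nra. }
    assert (Hp : 2 * N * (y - x) = m + A * (x - x0)).
    { assert (2 * N * (y - x) - (m + A * (x - x0)) = 0); [|lra].
      apply (linear_le_quadratic_zero _ (N + A / 2) r Hr). intros h Hh.
      assert (H := Hmax s y t (x + h) HD (conj Ht (Hr2 h Hh))). nra. }
    exists s, y, t, x. repeat (split; [assumption|]).
    rewrite Hq, Hp. exists n, r. split; [auto|]. intros s' y' HD' Hs' Hy'.
    (* Moving the base point by the same vector as the convolution point leaves the convolution
       penalty unchanged, so only the variation of [phi] remains. *)
    assert (H := Hmax s' y' (t + (s' - s)) (x + (y' - y)) HD'
      (conj (Hr1 _ Hs') (Hr2 _ Hy'))).
    replace (s' - (t + (s' - s))) with (s - t) in H by ring.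
    replace (y' - (x + (y' - y))) with (y - x) in H by ring.
    nra.
Qed.

(** [al] is the infimum of the second difference quotients up to scale [r]; it is finite because the
    maximizer at [(t0, x0)] bounds them below by [- 2 * N]. A nearly optimal scale feeds
    [sup_conv_curved_jet], and the upper paraboloid at [(t0, x0)] keeps the resulting gradient close
    to the central one. *)
Lemma sup_conv_jet_near (lo hi xlo xhi N : R) (u uh : R -> R -> R) (s0 y0 t0 x0 r : R) :
  lo <= hi -> xlo <= xhi -> usc_rect lo hi xlo xhi u -> 0 < N ->
  is_sup_conv (rect lo hi xlo xhi) u N uh ->
  rect lo hi xlo xhi s0 y0 ->
  uh t0 x0 = u s0 y0 - N * ((s0 - t0) ^ 2 + (y0 - x0) ^ 2) ->
  (forall t x, uh t x <= uh t0 x0 + 2 * N * (s0 - t0) * (t - t0) +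
     2 * N * (y0 - x0) * (x - x0) + N * ((t - t0) ^ 2 + (x - x0) ^ 2)) ->
  Rabs (s0 - t0) <= 1 -> Rabs (y0 - x0) <= 1 -> 0 < r <= 1 ->
  exists al s y q p,
    (forall tau, 0 <= tau <= r ->
       al * tau ^ 2 <= uh t0 (x0 + tau) + uh t0 (x0 - tau) - 2 * uh t0 x0) /\
    rect lo hi xlo xhi s y /\ Rabs (s - s0) <= 6 * r /\ Rabs (y - y0) <= 6 * r /\
    Rabs (q - 2 * N * (s0 - t0)) <= 10 * N * r /\ Rabs (p - 2 * N * (y0 - x0)) <= 10 * N * r /\
    u s0 y0 - 120 * N * r <= u s y /\
    quad_above (rect lo hi xlo xhi) u s y q p (al + r).
Proof.
  intros Hlo Hxx Hu HN Hsc HD0 Huh0 Htouch Hst Hyx Hr.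
  assert (Hub := proj1 Hsc).
  set (D := fun tau => uh t0 (x0 + tau) + uh t0 (x0 - tau) - 2 * uh t0 x0).
  assert (HDlow : forall tau, - (2 * N) * tau ^ 2 <= D tau).
  { intro tau. unfold D. assert (H1 := Hub t0 (x0 + tau) s0 y0 HD0).
    assert (H2 := Hub t0 (x0 - tau) s0 y0 HD0). rewrite Huh0. nra. }
  set (E := fun v => exists tau, 0 < tau <= r /\ v = - (D tau / tau ^ 2)).
  assert (HEne : exists v, E v) by (exists (- (D r / r ^ 2)), r; split; auto; lra).
  assert (HEb : forall v, E v -> v <= 2 * N).
  { intros v [tau [Ht ->]]. assert (0 < tau ^ 2) by (apply pow_lt; lra).
    specialize (HDlow tau). apply Rmult_le_reg_r with (tau ^ 2); auto.
    replace (- (D tau / tau ^ 2) * tau ^ 2) with (- D tau) by (field; lra). lra. }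
  destruct (Rsup_approx E (2 * N) r HEne HEb) as [v [[tau [Htau ->]] Hv]]; [lra|].
  set (al := - Rsup E) in *.
  assert (Htau2 : 0 < tau ^ 2) by (apply pow_lt; lra).
  assert (HDt : D tau < (al + r) * tau ^ 2).
  { replace (D tau) with (D tau / tau ^ 2 * tau ^ 2) by (field; lra).
    apply Rmult_lt_compat_r; auto. unfold al. lra. }
  destruct (sup_conv_curved_jet lo hi xlo xhi N u uh t0 x0 tau (al + r))
    as (s & y & t & x & HD & Ht & Hx & Huh & Hjet); auto; [lra|].
  assert (Htr : Rabs (t - t0) <= r) by lra.
  assert (Hxr : Rabs (x - x0) <= r) by lra.
  assert (Ht2 := sq_le_of_abs _ _ Htr). assert (Hx2 := sq_le_of_abs _ _ Hxr).
  assert (Hlow := Hub t x s0 y0 HD0).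
  (* Between the lower paraboloid of [(s, y)] at [(t, x)] and the assumed upper one at [(t0, x0)], a
     gradient gap tested on a vector of length [r] costs at most [9 * N * r ^ 2], rounded up to
     10. *)
  assert (Hgrad : forall d e, d ^ 2 + e ^ 2 = r ^ 2 ->
     (2 * N * (s - t) - 2 * N * (s0 - t0)) * d + (2 * N * (y - x) - 2 * N * (y0 - x0)) * e
       <= 10 * N * r ^ 2).
  { intros d e Hde.
    assert (H1 := Hub (t + d) (x + e) s y HD). assert (H2 := Htouch (t + d) (x + e)).
    assert (H4 : (t + d - t0) ^ 2 + (x + e - x0) ^ 2 <=
       2 * ((t - t0) ^ 2 + (x - x0) ^ 2) + 2 * r ^ 2).
    { assert (0 <= (d - (t - t0)) ^ 2) by apply pow2_ge_0.
      assert (0 <= (e - (x - x0)) ^ 2) by apply pow2_ge_0. nra. }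
    assert (H5 : N * ((t + d - t0) ^ 2 + (x + e - x0) ^ 2 + (t - t0) ^ 2 + (x - x0) ^ 2 +
       (d ^ 2 + e ^ 2)) <= N * (10 * r ^ 2)).
    { pose proof (pow2_ge_0 r). apply Rmult_le_compat_l; lra. }
    nra. }
  assert (Hbd : forall z, z * r <= 10 * N * r ^ 2 -> z * - r <= 10 * N * r ^ 2 ->
     Rabs z <= 10 * N * r).
  { intros z H1 H2. apply Rabs_le. split; apply Rmult_le_reg_r with r; lra. }
  assert (Hq : Rabs (2 * N * (s - t) - 2 * N * (s0 - t0)) <= 10 * N * r).
  { apply Hbd; [assert (H := Hgrad r 0 ltac:(ring))|assert (H := Hgrad (- r) 0 ltac:(ring))];
      lra. }
  assert (Hp : Rabs (2 * N * (y - x) - 2 * N * (y0 - x0)) <= 10 * N * r).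
  { apply Hbd; [assert (H := Hgrad 0 r ltac:(ring))|assert (H := Hgrad 0 (- r) ltac:(ring))];
      lra. }
  assert (Hclose : forall z z0 k k0, Rabs (2 * N * (z - k) - 2 * N * (z0 - k0)) <= 10 * N * r ->
     Rabs (k - k0) <= r -> Rabs (z - z0) <= 6 * r).
  { intros z z0 k k0 H1 H2. apply Rabs_le_bounds in H1. apply Rabs_le_bounds in H2.
    apply Rabs_le. split; apply Rmult_le_reg_l with (2 * N); nra. }
  assert (Hs := Hclose _ _ _ _ Hq Htr). assert (Hy := Hclose _ _ _ _ Hp Hxr).
  exists al, s, y, (2 * N * (s - t)), (2 * N * (y - x)).
  split; [|repeat (split; [assumption|]); split; [|exact Hjet]].
  - intros tau' [Ht0 Htr']. fold (D tau').
    destruct Ht0 as [Hpos|<-].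
    + assert (0 < tau' ^ 2) by (apply pow_lt; auto).
      assert (H1 : - (D tau' / tau' ^ 2) <= Rsup E).
      { apply (Rsup_ub _ (2 * N)); auto. exists tau'; split; auto. }
      replace (D tau') with (D tau' / tau' ^ 2 * tau' ^ 2) by (field; lra).
      apply Rmult_le_compat_r; [lra|]. unfold al. lra.
    + unfold D. rewrite Rplus_0_r, Rminus_0_r. lra.
  - assert (Hprod : forall z z0 k k0, Rabs (z - z0) <= 6 * r -> Rabs (k - k0) <= r ->
      Rabs (z0 - k0) <= 1 -> (z0 - k) ^ 2 - (z - k) ^ 2 <= 60 * r).
    { intros z z0 k k0 H1 H2 H3.
      replace ((z0 - k) ^ 2 - (z - k) ^ 2) with
        ((z0 - z) * ((z - z0) + 2 * (z0 - k0) + 2 * (k0 - k))) by ring.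
      eapply Rle_trans; [apply Rle_abs|]. rewrite Rabs_mult, Rabs_minus_sym.
      replace (60 * r) with (6 * r * 10) by ring.
      apply Rmult_le_compat; auto using Rabs_pos.
      apply Rabs_le_bounds in H1. apply Rabs_le_bounds in H2. apply Rabs_le_bounds in H3.
      apply Rabs_le; lra. }
    assert (P1 := Hprod _ _ _ _ Hs Htr Hst). assert (P2 := Hprod _ _ _ _ Hy Hxr Hyx).
    assert (H : N * ((s0 - t) ^ 2 - (s - t) ^ 2 + ((y0 - x) ^ 2 - (y - x) ^ 2)) <= N * (120 * r))
      by (apply Rmult_le_compat_l; lra).
    lra.
Qed.

(* The theorem on sums (Ishii's lemma): [A] and [A'] below are the second-order parts of
   upper jets of [u] and [w], at points and with gradients close to those given by the
   doubling maximum. *)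
Lemma theorem_on_sums (lo hi xlo xhi n : R) (u w : R -> R -> R) (s0 y0 s1 y1 r : R) :
  usc_rect lo hi xlo xhi u -> usc_rect lo hi xlo xhi w -> 0 < n ->
  rect lo hi xlo xhi s0 y0 -> rect lo hi xlo xhi s1 y1 ->
  (forall s y s' y', rect lo hi xlo xhi s y -> rect lo hi xlo xhi s' y' ->
     u s y + w s' y' - n * ((s - s') ^ 2 + (y - y') ^ 2) <=
     u s0 y0 + w s1 y1 - n * ((s0 - s1) ^ 2 + (y0 - y1) ^ 2)) ->
  Rabs (s0 - s1) <= 1 -> Rabs (y0 - y1) <= 1 -> 0 < r <= 1 ->
  exists A A' s y q p s' y' q' p',
    (rect lo hi xlo xhi s y /\ Rabs (s - s0) <= 6 * r /\ Rabs (y - y0) <= 6 * r /\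
     Rabs (q - 2 * n * (s0 - s1)) <= 30 * n * r /\
     Rabs (p - 2 * n * (y0 - y1)) <= 30 * n * r /\
     u s0 y0 - 360 * n * r <= u s y /\ quad_above (rect lo hi xlo xhi) u s y q p A) /\
    (rect lo hi xlo xhi s' y' /\ Rabs (s' - s1) <= 6 * r /\ Rabs (y' - y1) <= 6 * r /\
     Rabs (q' + 2 * n * (s0 - s1)) <= 30 * n * r /\
     Rabs (p' + 2 * n * (y0 - y1)) <= 30 * n * r /\
     w s1 y1 - 360 * n * r <= w s' y' /\ quad_above (rect lo hi xlo xhi) w s' y' q' p' A') /\
    (forall be ga, (A - r) * be ^ 2 + (A' - r) * ga ^ 2 <= 6 * n * (be - ga) ^ 2).
Proof.
  intros Hu Hw Hn HD0 HD1 Hmax Hs Hy Hr.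
  assert (Hlo : lo <= hi) by (unfold rect in HD0; lra).
  assert (Hxx : xlo <= xhi) by (unfold rect in HD0; lra).
  (* The factor 3 comes from [(a + b + c)^2 <= 3 (a^2 + b^2 + c^2)], used in [Hchain] to pass
     through the two base points. Equality holds when the increments agree, which is why the base
     points below trisect the segment from [(s0, y0)] to [(s1, y1)]. *)
  set (N := 3 * n).
  destruct (sup_conv_exists lo hi xlo xhi N u Hlo Hxx Hu) as [uh Hsu].
  destruct (sup_conv_exists lo hi xlo xhi N w Hlo Hxx Hw) as [wh Hsw].
  set (t0 := (2 * s0 + s1) / 3). set (x0 := (2 * y0 + y1) / 3).
  set (t1 := (s0 + 2 * s1) / 3). set (x1 := (y0 + 2 * y1) / 3).
  set (m := u s0 y0 + w s1 y1 - n * ((s0 - s1) ^ 2 + (y0 - y1) ^ 2)) in *.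
  assert (Hchain : forall t x t' x',
     uh t x + wh t' x' <= m + N * ((t - t') ^ 2 + (x - x') ^ 2)).
  { intros t x t' x'. destruct (proj2 Hsu t x) as (s & y & HD & ->).
    destruct (proj2 Hsw t' x') as (s' & y' & HD' & ->).
    specialize (Hmax s y s' y' HD HD').
    assert (Hsq : forall z k k' z', (z - z') ^ 2 <= 3 * ((z - k) ^ 2 + (k - k') ^ 2 + (z' - k') ^ 2)).
    { intros z k k' z'. assert (0 <= ((z - k) - (k - k')) ^ 2) by apply pow2_ge_0.
      assert (0 <= ((z - k) + (z' - k')) ^ 2) by apply pow2_ge_0.
      assert (0 <= ((k - k') + (z' - k')) ^ 2) by apply pow2_ge_0. nra. }
    assert (S1 := Hsq s t t' s'). assert (S2 := Hsq y x x' y').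
    assert (n * ((s - s') ^ 2 + (y - y') ^ 2) <=
      n * (3 * ((s - t) ^ 2 + (t - t') ^ 2 + (s' - t') ^ 2) +
           3 * ((y - x) ^ 2 + (x - x') ^ 2 + (y' - x') ^ 2)))
      by (apply Rmult_le_compat_l; lra).
    unfold N. lra. }
  assert (Hu0 := proj1 Hsu t0 x0 s0 y0 HD0). assert (Hw1 := proj1 Hsw t1 x1 s1 y1 HD1).
  assert (Hc := Hchain t0 x0 t1 x1).
  assert (Hid : N * ((t0 - t1) ^ 2 + (x0 - x1) ^ 2) + m =
    u s0 y0 - N * ((s0 - t0) ^ 2 + (y0 - x0) ^ 2) +
    (w s1 y1 - N * ((s1 - t1) ^ 2 + (y1 - x1) ^ 2))).
  { unfold m, N, t0, x0, t1, x1. field. }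
  destruct (sup_conv_jet_near lo hi xlo xhi N u uh s0 y0 t0 x0 r)
    as (al & s & y & q & p & Hal & J1 & J2 & J3 & J4 & J5 & J6 & J7); auto;
    [unfold N; lra|lra| | | |].
  { intros t x. assert (H := Hchain t x t1 x1).
    assert (Hi : N * ((t - t1) ^ 2 + (x - x1) ^ 2) = N * ((t0 - t1) ^ 2 + (x0 - x1) ^ 2) +
      2 * N * (s0 - t0) * (t - t0) + 2 * N * (y0 - x0) * (x - x0) +
      N * ((t - t0) ^ 2 + (x - x0) ^ 2)) by (unfold t0, x0, t1, x1; field).
    lra. }
  { replace (s0 - t0) with ((s0 - s1) / 3) by (unfold t0; field).
    apply Rabs_le_bounds in Hs. apply Rabs_le; lra. }
  { replace (y0 - x0) with ((y0 - y1) / 3) by (unfold x0; field).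
    apply Rabs_le_bounds in Hy. apply Rabs_le; lra. }
  destruct (sup_conv_jet_near lo hi xlo xhi N w wh s1 y1 t1 x1 r)
    as (al' & s' & y' & q' & p' & Hal' & K1 & K2 & K3 & K4 & K5 & K6 & K7); auto;
    [unfold N; lra|lra| | | |].
  { intros t x. assert (H := Hchain t0 x0 t x).
    assert (Hi : N * ((t0 - t) ^ 2 + (x0 - x) ^ 2) = N * ((t0 - t1) ^ 2 + (x0 - x1) ^ 2) +
      2 * N * (s1 - t1) * (t - t1) + 2 * N * (y1 - x1) * (x - x1) +
      N * ((t - t1) ^ 2 + (x - x1) ^ 2)) by (unfold t0, x0, t1, x1; field).
    lra. }
  { replace (s1 - t1) with (- ((s0 - s1) / 3)) by (unfold t1; field).
    apply Rabs_le_bounds in Hs. apply Rabs_le; lra. }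
  { replace (y1 - x1) with (- ((y0 - y1) / 3)) by (unfold x1; field).
    apply Rabs_le_bounds in Hy. apply Rabs_le; lra. }
  exists (al + r), (al' + r), s, y, q, p, s', y', q', p'.
  split; [|split].
  - repeat (split; [assumption|]). unfold N in *.
    replace (2 * (3 * n) * (s0 - t0)) with (2 * n * (s0 - s1)) in J4 by (unfold t0; field).
    replace (2 * (3 * n) * (y0 - x0)) with (2 * n * (y0 - y1)) in J5 by (unfold x0; field).
    repeat split; auto; lra.
  - repeat (split; [assumption|]). unfold N in *.
    replace (2 * (3 * n) * (s1 - t1)) with (- (2 * n * (s0 - s1))) in K4 by (unfold t1; field).
    replace (2 * (3 * n) * (y1 - x1)) with (- (2 * n * (y0 - y1))) in K5 by (unfold x1; field).
    unfold Rminus in K4 at 1, K5 at 1. rewrite Ropp_involutive in K4, K5.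
    repeat split; auto; lra.
  - assert (Hpos : forall be ga, 0 <= be -> 0 <= ga ->
      al * be ^ 2 + al' * ga ^ 2 <= 6 * n * (be - ga) ^ 2).
    { intros be ga Hbe Hga. set (k := r / (be + ga + 1)).
      assert (Hk : 0 < k) by (apply Rdiv_lt_0_compat; lra).
      assert (Hkr : k * (be + ga + 1) = r) by (unfold k; field; lra).
      assert (H1 := Hal (k * be) ltac:(nra)). assert (H2 := Hal' (k * ga) ltac:(nra)).
      assert (C1 := Hchain t0 (x0 + k * be) t1 (x1 + k * ga)).
      assert (C2 := Hchain t0 (x0 - k * be) t1 (x1 - k * ga)).
      assert (Hk2 : 0 < k ^ 2) by (apply pow_lt; auto).
      apply Rmult_le_reg_l with (k ^ 2); auto.
      unfold N in *. nra. }
    intros be ga. specialize (Hpos (Rabs be) (Rabs ga) (Rabs_pos _) (Rabs_pos _)).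
    rewrite !pow2_abs in Hpos.
    assert (Hsq : (Rabs be - Rabs ga) ^ 2 <= (be - ga) ^ 2).
    { rewrite <- (pow2_abs (be - ga)), <- (pow2_abs (Rabs be - Rabs ga)).
      apply pow_incr. split; [apply Rabs_pos|]. apply Rabs_triang_inv2. }
    assert (6 * n * (Rabs be - Rabs ga) ^ 2 <= 6 * n * (be - ga) ^ 2)
      by (apply Rmult_le_compat_l; lra).
    lra.
Qed.

(** * Comparison *)

(** Semicontinuity and compactness give one radius [dl] within which decoupling the two points gains
    at most [rp] over the strict bound. A large [n] brings the doubled points that close; then [rp]
    bounds both the doubling penalty and the distance term. *)
Lemma doubling_localized (lo hi xlo xhi th : R) (u w : R -> R -> R) (sb yb rho : R) :
  usc_rect lo hi xlo xhi u -> usc_rect lo hi xlo xhi w -> rect lo hi xlo xhi sb yb ->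
  0 < th ->
  (forall s y, rect lo hi xlo xhi s y ->
     u s y + w s y <= u sb yb + w sb yb - th * ((s - sb) ^ 2 + (y - yb) ^ 2)) ->
  0 < rho <= 1 ->
  exists n s0 y0 s1 y1, 0 < n /\ rect lo hi xlo xhi s0 y0 /\ rect lo hi xlo xhi s1 y1 /\
    (forall s y s' y', rect lo hi xlo xhi s y -> rect lo hi xlo xhi s' y' ->
       u s y + w s' y' - n * ((s - s') ^ 2 + (y - y') ^ 2) <=
       u s0 y0 + w s1 y1 - n * ((s0 - s1) ^ 2 + (y0 - y1) ^ 2)) /\
    Rabs (s0 - sb) < rho /\ Rabs (y0 - yb) < rho /\
    Rabs (s1 - sb) < rho /\ Rabs (y1 - yb) < rho /\
    Rabs (s0 - s1) <= 1 /\ Rabs (y0 - y1) <= 1 /\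
    n * (y0 - y1) ^ 2 <= rho /\ u sb yb - rho <= u s0 y0.
Proof.
  intros Hu Hw HDb Hth Hstrict Hrho.
  set (Dp := fun P : R * R => lo <= fst P <= hi /\ xlo <= snd P <= xhi).
  set (dp := dprod Rdist Rdist).
  set (m0 := u sb yb + w sb yb) in *.
  destruct (Hw (sb, yb) HDb rho) as [dw [Hdw Hwb]]; [lra|]. simpl in Hwb.
  set (rb := Rmin rho dw).
  assert (Hrb : 0 < rb) by (apply Rmin_glb_lt; lra).
  assert (Hrb1 : rb <= rho) by apply Rmin_l. assert (Hrb2 : rb <= dw) by apply Rmin_r.
  (* The first bound controls [n * (y0 - y1) ^ 2]; the second places [(s0, y0)] within [rb / 2] of
     [(sb, yb)]. *)
  set (rp := Rmin (rho / 2) (th * (rb / 2) ^ 2)).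
  assert (Hrb4 : 0 < (rb / 2) ^ 2) by (apply pow_lt; lra).
  assert (Hrp : 0 < rp) by (apply Rmin_glb_lt; [lra|now apply Rmult_lt_0_compat]).
  assert (Hrp1 : rp <= rho / 2) by apply Rmin_l.
  assert (Hrp2 : rp <= th * (rb / 2) ^ 2) by apply Rmin_r.
  destruct (compact_uniform dp Dp (fun e P => forall Q, Dp Q -> dp Q P < e ->
      u (fst P) (snd P) + w (fst Q) (snd Q) <=
      m0 - th * ((fst P - sb) ^ 2 + (snd P - yb) ^ 2) + rp) (compact_rect lo hi xlo xhi))
    as [dl [Hdl Htube]].
  { intros e e' P Hee HP Q HQ HQP. apply HP; auto. lra. }
  { intros P HP.
    assert (Hu' : usc_within dp Dp (fun P => u (fst P) (snd P) +
       th * ((fst P - sb) ^ 2 + (snd P - yb) ^ 2))).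
    { apply usc_plus; [exact Hu|]. apply cont_usc.
      pose proof (cont_rect_fst lo hi xlo xhi). pose proof (cont_rect_snd lo hi xlo xhi).
      fold Dp in H, H0. fold dp in H, H0. cont_tac. }
    destruct (Hu' P HP (rp / 2)) as [d1 [Hd1 H1]]; [lra|].
    destruct (Hw P HP (rp / 2)) as [d2 [Hd2 H2]]; [lra|].
    exists (Rmin d1 d2 / 2).
    assert (Hd : 0 < Rmin d1 d2) by (apply Rmin_glb_lt; auto).
    pose proof (Rmin_l d1 d2). pose proof (Rmin_r d1 d2).
    split; [lra|]. intros P' HP' HPP Q HQ HQP.
    assert (HQP2 : dp Q P < d2).
    { assert (dp Q P <= dp Q P' + dp P' P); [|lra].
      unfold dp, dprod, Rdist. apply Rmax_lub.
      - replace (fst Q - fst P) with ((fst Q - fst P') + (fst P' - fst P)) by ring.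
        eapply Rle_trans; [apply Rabs_triang|].
        apply Rplus_le_compat; apply Rmax_l.
      - replace (snd Q - snd P) with ((snd Q - snd P') + (snd P' - snd P)) by ring.
        eapply Rle_trans; [apply Rabs_triang|].
        apply Rplus_le_compat; apply Rmax_r. }
    specialize (H1 P' HP' ltac:(lra)). specialize (H2 Q HQ HQP2).
    assert (H3 := Hstrict (fst P) (snd P) HP). lra. }
  destruct (rect2_max lo hi xlo xhi lo hi xlo xhi u w (fun _ _ _ _ => 0) Hu Hw)
    as (sm & ym & sm' & ym' & _ & _ & Hbd).
  { intros. apply cont_cst. }
  { now exists sb, yb. }
  { now exists sb, yb. }
  (* The largest gain from full decoupling; it bounds the doubling penalty for every [n]. *)
  set (Kb := u sm ym + w sm' ym' - m0).
  assert (HKb : 0 <= Kb) by (assert (H := Hbd sb yb sb yb HDb HDb); unfold Kb, m0; lra).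
  set (de := Rmin dl (rb / 2)).
  assert (Hde : 0 < de) by (apply Rmin_glb_lt; lra).
  assert (Hde1 : de <= dl) by apply Rmin_l. assert (Hde2 : de <= rb / 2) by apply Rmin_r.
  assert (Hde3 : 0 < de ^ 2) by (apply pow_lt; auto).
  set (n := (Kb + 1) / de ^ 2).
  assert (Hn : 0 < n) by (apply Rdiv_lt_0_compat; lra).
  assert (Hnde : n * de ^ 2 = Kb + 1) by (unfold n; field; lra).
  destruct (rect2_max lo hi xlo xhi lo hi xlo xhi u w
    (fun s y s' y' => (- n) * ((s - s') ^ 2 + (y - y') ^ 2)) Hu Hw)
    as (s0 & y0 & s1 & y1 & HD0 & HD1 & Hmax).
  { intros. cont_tac. }
  { now exists sb, yb. }
  { now exists sb, yb. }
  assert (H0 := Hmax sb yb sb yb HDb HDb). rewrite !Rminus_diag in H0.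
  assert (H1 := Hbd s0 y0 s1 y1 HD0 HD1).
  assert (Hsum : n * ((s0 - s1) ^ 2 + (y0 - y1) ^ 2) <= Kb) by (unfold Kb, m0; lra).
  pose proof (pow2_ge_0 (s0 - s1)) as Hs2. pose proof (pow2_ge_0 (y0 - y1)) as Hy2.
  assert (Habs : forall z, n * z ^ 2 <= Kb -> Rabs z < de).
  { intros z Hz. apply Rnot_le_lt; intro Hle.
    assert (de ^ 2 <= z ^ 2) by (rewrite <- (pow2_abs z); apply pow_incr; lra).
    assert (n * de ^ 2 <= n * z ^ 2) by (apply Rmult_le_compat_l; lra). lra. }
  assert (Hs : Rabs (s0 - s1) < de) by (apply Habs; nra).
  assert (Hy : Rabs (y0 - y1) < de) by (apply Habs; nra).
  assert (Ht := Htube (s0, y0) HD0 (s1, y1) HD1). simpl in Ht.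
  assert (Hdp : dp (s1, y1) (s0, y0) < dl).
  { unfold dp, dprod, Rdist; simpl. apply Rmax_lub_lt; rewrite Rabs_minus_sym; lra. }
  specialize (Ht Hdp).
  assert (Hkey : n * ((s0 - s1) ^ 2 + (y0 - y1) ^ 2) +
     th * ((s0 - sb) ^ 2 + (y0 - yb) ^ 2) <= rp) by (unfold m0 in Ht; simpl in *; lra).
  assert (Hnn : 0 <= n * ((s0 - s1) ^ 2 + (y0 - y1) ^ 2)) by (apply Rmult_le_pos; lra).
  assert (Habs2 : forall z z', 0 <= z' ^ 2 -> th * (z ^ 2 + z' ^ 2) <= rp -> Rabs z <= rb / 2).
  { intros z z' Hz' Hz. apply Rnot_lt_le; intro Hlt.
    assert ((rb / 2) ^ 2 < z ^ 2).
    { rewrite <- (pow2_abs z). simpl. rewrite !Rmult_1_r.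
      apply Rmult_le_0_lt_compat; lra. }
    assert (th * (rb / 2) ^ 2 < th * (z ^ 2 + z' ^ 2)) by (apply Rmult_lt_compat_l; lra).
    lra. }
  pose proof (pow2_ge_0 (s0 - sb)) as Hsb2. pose proof (pow2_ge_0 (y0 - yb)) as Hyb2.
  assert (Hsb : Rabs (s0 - sb) <= rb / 2) by (apply (Habs2 _ (y0 - yb)); lra).
  assert (Hyb : Rabs (y0 - yb) <= rb / 2) by (apply (Habs2 _ (s0 - sb)); lra).
  assert (Hsb1 : Rabs (s1 - sb) < rb).
  { replace (s1 - sb) with ((s0 - sb) - (s0 - s1)) by ring.
    eapply Rle_lt_trans; [apply Rabs_triang|]. rewrite Rabs_Ropp. lra. }
  assert (Hyb1 : Rabs (y1 - yb) < rb).
  { replace (y1 - yb) with ((y0 - yb) - (y0 - y1)) by ring.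
    eapply Rle_lt_trans; [apply Rabs_triang|]. rewrite Rabs_Ropp. lra. }
  assert (HwQ : w s1 y1 < w sb yb + rho).
  { apply (Hwb (s1, y1) HD1). unfold dprod, Rdist; simpl. apply Rmax_lub_lt; lra. }
  exists n, s0, y0, s1, y1.
  split; [auto|]. split; [auto|]. split; [auto|]. split.
  { intros s y s' y' HD HD'. specialize (Hmax s y s' y' HD HD'). lra. }
  assert (Hth0 : 0 <= th * ((s0 - sb) ^ 2 + (y0 - yb) ^ 2)) by (apply Rmult_le_pos; lra).
  assert (Hnn2 : 0 <= n * (s0 - s1) ^ 2) by (apply Rmult_le_pos; lra).
  repeat split; try lra.
Qed.

(** The quadratic form is tested on [(b, b')]; the Lipschitz bound turns [n * (b - b') ^ 2] into
    [L ^ 2 * n * (y - y') ^ 2], which the doubling bound keeps small. The 288 is [2 * 12 ^ 2], from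
    two displacements of size [6 * r]. *)
Lemma diffusion_estimate (L Lb n r rho A A' b b' y y' y0 y1 : R) :
  0 <= L -> 0 < n -> 0 < r <= 1 ->
  Rabs (b - b') <= L * Rabs (y - y') -> Rabs b <= Lb -> Rabs b' <= Lb ->
  (forall be ga, (A - r) * be ^ 2 + (A' - r) * ga ^ 2 <= 6 * n * (be - ga) ^ 2) ->
  n * (y0 - y1) ^ 2 <= rho -> Rabs (y - y0) <= 6 * r -> Rabs (y' - y1) <= 6 * r ->
  / 2 * (b ^ 2 * A + b' ^ 2 * A') <= 3 * L ^ 2 * (2 * rho + 288 * n * r) + r * Lb ^ 2.
Proof.
  intros HL Hn Hr Hbb Hb Hb' Hmat Hrho Hy Hy'.
  assert (Hb2 := sq_le_of_abs _ _ Hb). assert (Hb2' := sq_le_of_abs _ _ Hb').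
  assert (Hbb2 : (b - b') ^ 2 <= L ^ 2 * (y - y') ^ 2).
  { rewrite <- (pow2_abs (y - y')), <- Rpow_mult_distr. now apply sq_le_of_abs. }
  assert (Hyy : (y - y') ^ 2 <= 2 * (y0 - y1) ^ 2 + 288 * r).
  { set (e := (y - y0) - (y' - y1)).
    assert (He : Rabs e <= 12 * r).
    { apply Rabs_le_bounds in Hy. apply Rabs_le_bounds in Hy'. apply Rabs_le. unfold e. lra. }
    assert (He2 := sq_le_of_abs _ _ He).
    replace (y - y') with ((y0 - y1) + e) by (unfold e; ring).
    assert (0 <= ((y0 - y1) - e) ^ 2) by apply pow2_ge_0. nra. }
  assert (Hn2 : n * (y - y') ^ 2 <= 2 * rho + 288 * n * r) by nra.
  specialize (Hmat b b').
  assert (n * (b - b') ^ 2 <= L ^ 2 * (2 * rho + 288 * n * r)).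
  { apply Rle_trans with (L ^ 2 * (n * (y - y') ^ 2)).
    - replace (L ^ 2 * (n * (y - y') ^ 2)) with (n * (L ^ 2 * (y - y') ^ 2)) by ring.
      apply Rmult_le_compat_l; lra.
    - apply Rmult_le_compat_l; auto. apply pow2_ge_0. }
  assert (r * b ^ 2 <= r * Lb ^ 2) by (apply Rmult_le_compat_l; lra).
  assert (r * b' ^ 2 <= r * Lb ^ 2) by (apply Rmult_le_compat_l; lra).
  lra.
Qed.

(** The two gradients are nearly opposite, so only [(a - a') * 2 * n * (y0 - y1)] survives, and its
    size is again of order [n * (y0 - y1) ^ 2]. *)
Lemma drift_estimate (L Lb n r rho a a' p p' y y' y0 y1 : R) :
  0 <= L -> 0 < n -> 0 < r <= 1 ->
  Rabs (a - a') <= L * Rabs (y - y') -> Rabs a <= Lb -> Rabs a' <= Lb ->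
  Rabs (p - 2 * n * (y0 - y1)) <= 30 * n * r ->
  Rabs (p' + 2 * n * (y0 - y1)) <= 30 * n * r ->
  n * (y0 - y1) ^ 2 <= rho -> Rabs (y0 - y1) <= 1 ->
  Rabs (y - y0) <= 6 * r -> Rabs (y' - y1) <= 6 * r ->
  a * p + a' * p' <= 60 * Lb * n * r + L * (2 * rho + 24 * n * r).
Proof.
  intros HL Hn Hr Haa Ha Ha' Hp Hp' Hrho H1 Hy Hy'.
  replace (a * p + a' * p') with
    (a * (p - 2 * n * (y0 - y1)) + a' * (p' + 2 * n * (y0 - y1)) +
     (a - a') * (2 * n * (y0 - y1))) by ring.
  assert (E1 : a * (p - 2 * n * (y0 - y1)) <= Lb * (30 * n * r)).
  { eapply Rle_trans; [apply Rle_abs|]. rewrite Rabs_mult.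
    apply Rmult_le_compat; auto using Rabs_pos. }
  assert (E2 : a' * (p' + 2 * n * (y0 - y1)) <= Lb * (30 * n * r)).
  { eapply Rle_trans; [apply Rle_abs|]. rewrite Rabs_mult.
    apply Rmult_le_compat; auto using Rabs_pos. }
  set (z := Rabs (y0 - y1)) in *.
  assert (Hz : 0 <= z) by apply Rabs_pos.
  assert (Hyy : Rabs (y - y') <= z + 12 * r).
  { replace (y - y') with ((y0 - y1) + ((y - y0) - (y' - y1))) by ring.
    eapply Rle_trans; [apply Rabs_triang|]. apply Rplus_le_compat_l.
    apply Rabs_le_bounds in Hy. apply Rabs_le_bounds in Hy'. apply Rabs_le; lra. }
  assert (E3 : (a - a') * (2 * n * (y0 - y1)) <= L * (z + 12 * r) * (2 * n * z)).
  { eapply Rle_trans; [apply Rle_abs|].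
    rewrite Rabs_mult, (Rabs_mult (2 * n)), (Rabs_pos_eq (2 * n)) by lra.
    apply Rmult_le_compat; auto using Rabs_pos.
    - apply Rmult_le_pos; [lra|apply Rabs_pos].
    - eapply Rle_trans; [exact Haa|]. apply Rmult_le_compat_l; auto.
    - apply Rle_refl. }
  assert (Hz2 : n * z ^ 2 <= rho) by (unfold z; rewrite pow2_abs; auto).
  assert (E4 : (z + 12 * r) * (2 * n * z) <= 2 * rho + 24 * n * r).
  { assert (n * r * z <= n * r * 1) by (apply Rmult_le_compat_l; nra). nra. }
  assert (L * ((z + 12 * r) * (2 * n * z)) <= L * (2 * rho + 24 * n * r))
    by (apply Rmult_le_compat_l; auto).
  lra.
Qed.

(* The contribution of the penalty [th x^2 + th |P - Pb|^2] to the Hamiltonian. *)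
Lemma penalty_estimate (L th ka a b y yb : R) :
  0 <= L -> 0 < th <= ka -> th * yb ^ 2 <= 2 * ka -> Rabs (y - yb) <= 1 ->
  Rabs a <= L * (1 + Rabs y) -> Rabs b <= L * (1 + Rabs y) ->
  / 2 * b ^ 2 * (4 * th) + a * (2 * th * y + 2 * th * (y - yb)) <= ka * (28 * L ^ 2 + 28 * L).
Proof.
  intros HL Hth Hyb Hy Ha Hb.
  pose proof (Rabs_pos y) as Hy0.
  assert (Hyy : (1 + Rabs y) ^ 2 <= 6 + 4 * yb ^ 2).
  { assert (Hy2 := sq_le_of_abs _ _ Hy).
    assert (0 <= (1 - Rabs y) ^ 2) by apply pow2_ge_0.
    assert (Rabs y ^ 2 = y ^ 2) by apply pow2_abs.
    assert (0 <= (y - 2 * yb) ^ 2) by apply pow2_ge_0. nra. }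
  (* The quadratic growth of the coefficients is paid for by the smallness of [th * yb ^ 2],
     although [yb] itself is not controlled; 14 is [6 + 4 * 2]. *)
  assert (Hty : th * (1 + Rabs y) ^ 2 <= 14 * ka) by nra.
  assert (Hb2 := sq_le_of_abs _ _ Hb). rewrite Rpow_mult_distr in Hb2.
  assert (E1 : th * b ^ 2 <= L ^ 2 * (14 * ka)).
  { apply Rle_trans with (th * (L ^ 2 * (1 + Rabs y) ^ 2)).
    - apply Rmult_le_compat_l; lra.
    - replace (th * (L ^ 2 * (1 + Rabs y) ^ 2)) with (L ^ 2 * (th * (1 + Rabs y) ^ 2)) by ring.
      apply Rmult_le_compat_l; auto. apply pow2_ge_0. }
  assert (E2 : a * (y + (y - yb)) <= L * (1 + Rabs y) * (1 + Rabs y)).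
  { eapply Rle_trans; [apply Rle_abs|]. rewrite Rabs_mult.
    apply Rmult_le_compat; auto using Rabs_pos.
    eapply Rle_trans; [apply Rabs_triang|]. lra. }
  assert (E3 : th * (a * (y + (y - yb))) <= L * (14 * ka)).
  { apply Rle_trans with (th * (L * (1 + Rabs y) * (1 + Rabs y))).
    - apply Rmult_le_compat_l; lra.
    - replace (th * (L * (1 + Rabs y) * (1 + Rabs y))) with (L * (th * (1 + Rabs y) ^ 2)) by ring.
      apply Rmult_le_compat_l; auto. }
  lra.
Qed.

Lemma quad_above_strip (T : R) (u : R -> R -> R) (xlo xhi s y q p A : R) :
  xlo < y < xhi -> quad_above (rect 0 T xlo xhi) u s y q p A ->
  quad_above (strip T) u s y q p A.
Proof.
  intros Hy [n [d [Hd H]]].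
  exists n, (Rmin d (Rmin (y - xlo) (xhi - y))). split.
  - repeat apply Rmin_glb_lt; lra.
  - intros s' y' Hs' H1 H2.
    assert (D1 := Rlt_le_trans _ _ _ H1 (Rmin_l _ _)).
    assert (D2 := Rlt_le_trans _ _ _ H2 (Rmin_l _ _)).
    assert (D3 := Rlt_le_trans _ _ _ H2 (Rmin_r _ _)).
    assert (D4 := Rlt_le_trans _ _ _ D3 (Rmin_l _ _)).
    assert (D5 := Rlt_le_trans _ _ _ D3 (Rmin_r _ _)).
    apply H; auto. split; [exact Hs'|].
    apply Rabs_def2 in D4. apply Rabs_def2 in D5. lra.
Qed.

Lemma usc_on_plus (T : R) (u v : R -> R -> R) :
  usc_on T u -> usc_on T v -> usc_on T (fun s y => u s y + v s y).
Proof.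
  intros Hu Hv t x Ht eps He.
  destruct (Hu t x Ht (eps / 2)) as [d1 [Hd1 H1]]; [lra|].
  destruct (Hv t x Ht (eps / 2)) as [d2 [Hd2 H2]]; [lra|].
  exists (Rmin d1 d2); split; [now apply Rmin_glb_lt|]. intros s y Hs A1 A2.
  specialize (H1 s y Hs (Rlt_le_trans _ _ _ A1 (Rmin_l _ _)) (Rlt_le_trans _ _ _ A2 (Rmin_l _ _))).
  specialize (H2 s y Hs (Rlt_le_trans _ _ _ A1 (Rmin_r _ _)) (Rlt_le_trans _ _ _ A2 (Rmin_r _ _))).
  lra.
Qed.

Lemma usc_on_scale (T k : R) (u : R -> R -> R) :
  0 < k -> usc_on T u -> usc_on T (fun s y => k * u s y).
Proof.
  intros Hk Hu t x Ht eps He.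
  destruct (Hu t x Ht (eps / k)) as [d [Hd H]]; [now apply Rdiv_lt_0_compat|].
  exists d; split; auto. intros s y Hs A1 A2. specialize (H s y Hs A1 A2).
  replace eps with (k * (eps / k)) by (field; lra).
  rewrite <- Rmult_plus_distr_l. now apply Rmult_lt_compat_l.
Qed.

Lemma usc_on_separable (T : R) (h1 h2 : R -> R) :
  continuity h1 -> continuity h2 -> usc_on T (fun s y => h1 s + h2 y).
Proof.
  intros H1 H2 t x _ eps He.
  destruct (cont2_separable h1 h2 H1 H2 t x I eps He) as [d [Hd H]].
  exists d; split; auto. intros s y _ A1 A2. specialize (H s y I A1 A2).
  apply Rabs_def2 in H. lra.
Qed.

Lemma usc_on_ext (T : R) (u v : R -> R -> R) :
  (forall s y, u s y = v s y) -> usc_on T u -> usc_on T v.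
Proof.
  intros He Hu t x Ht eps Heps. destruct (Hu t x Ht eps Heps) as [d [Hd H]].
  exists d; split; auto. intros. rewrite <- !He. auto.
Qed.

(* [v] is the strict supersolution (1 - lam) V + lam (G + (M + 1)(T - t)). *)
Lemma no_positive_maximum {W Y : Type} (dW : W -> W -> R) (T : R)
  (a b : R -> W -> R) (f : R -> R -> W -> R) (g : R -> R)
  (Z : R -> R -> Y -> Prop) (Gam K : R -> R -> Y -> R) (U V : R -> R -> R)
  (L M lam G ka th tb xb eta rho : R) :
  inhabited W -> compact_set dW (fun _ => True) -> is_metric dW -> cont_TRX dW T f ->
  coef_bounds T a b f L M -> continuity g ->
  visc_sub T a b f g Z Gam K U -> visc_super T a b f g Z Gam K V ->
  let v s y := (1 - lam) * V s y + lam * (G + (M + 1) * (T - s)) in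
  0 < lam < 1 -> ka * (2 + 28 * L ^ 2 + 28 * L) <= lam / 4 ->
  0 < th <= ka -> th * xb ^ 2 <= 2 * ka -> 0 <= tb < T ->
  (forall s y, 0 <= s <= T -> U s y - v s y - th * y ^ 2 <= U tb xb - v tb xb - th * xb ^ 2) ->
  0 < eta -> 0 < rho ->
  (forall s y, 0 <= s <= T -> Rabs (s - tb) < rho -> Rabs (y - xb) < rho ->
     U tb xb - eta < U s y -> Mop Z Gam K U s y < U s y) ->
  False.
Proof.
  intros Hi HW Hd Hf HB Hg HU HV v Hlam Hka Hth Hthx Htb Hmax Heta Hrho Hnoimp.
  pose proof (cb_L _ _ _ _ _ _ HB) as HL. pose proof (cb_M _ _ _ _ _ _ HB) as HM.
  assert (Htb' : 0 <= tb <= T) by lra.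
  destruct (f_uniform dW T f tb xb (lam / 16) HW Hd Hf Htb') as [df [Hdf Hfu]]; [lra|].
  (* The second penalty makes the maximum at [(tb, xb)] strict, as [doubling_localized] requires. *)
  set (ut := fun s y => U s y - th * y ^ 2 - th * ((s - tb) ^ 2 + (y - xb) ^ 2)).
  set (w := fun s y => - v s y).
  assert (Hut : usc_rect 0 T (xb - 1) (xb + 1) ut).
  { apply (usc_on_strip T); [|lra|lra].
    apply (usc_on_ext T (fun s y => U s y +
      ((- th) * (s - tb) ^ 2 + (- th) * (y ^ 2 + (y - xb) ^ 2)))).
    - intros; unfold ut; ring.
    - apply usc_on_plus; [apply HU|]. apply usc_on_separable; reg. }
  assert (Hw : usc_rect 0 T (xb - 1) (xb + 1) w).
  { apply (usc_on_strip T); [|lra|lra].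
    apply (usc_on_ext T (fun s y => (1 - lam) * (- V s y) +
      ((- lam) * (G + (M + 1) * (T - s)) + 0))).
    - intros; unfold w, v; ring.
    - apply usc_on_plus; [apply usc_on_scale; [lra|apply lsc_on_opp, HV]|].
      apply (usc_on_separable T (fun s => (- lam) * (G + (M + 1) * (T - s))) (fun _ => 0)); reg. }
  set (Lb := L * (3 + Rabs xb)).
  pose proof (Rabs_pos xb) as Hxb0.
  assert (HLb : 0 <= Lb) by (apply Rmult_le_pos; lra).
  set (c1 := 6 * L ^ 2 + 2 * L + 1).
  assert (HL2 := pow2_ge_0 L).
  assert (Hc1 : 0 < c1) by (unfold c1; lra).
  set (c2 := th * (2 * Rabs xb + 1) + 1).
  assert (Hc2 : 0 < c2) by (unfold c2; assert (0 <= th * (2 * Rabs xb + 1)) by (apply Rmult_le_pos; lra); lra).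
  set (rd := Rmin (Rmin (Rmin rho df) (Rmin (T - tb) 1))
               (Rmin (Rmin (eta / 8) (eta / (8 * c2))) (lam / (16 * c1)))).
  assert (Hrd : 0 < rd).
  { repeat apply Rmin_glb_lt; try lra; apply Rdiv_lt_0_compat; lra. }
  assert (R1 : rd <= Rmin (Rmin rho df) (Rmin (T - tb) 1)) by apply Rmin_l.
  assert (R2 : rd <= Rmin (Rmin (eta / 8) (eta / (8 * c2))) (lam / (16 * c1))) by apply Rmin_r.
  pose proof (Rmin_l (Rmin rho df) (Rmin (T - tb) 1)).
  pose proof (Rmin_r (Rmin rho df) (Rmin (T - tb) 1)).
  pose proof (Rmin_l rho df). pose proof (Rmin_r rho df).
  pose proof (Rmin_l (T - tb) 1). pose proof (Rmin_r (T - tb) 1).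
  pose proof (Rmin_l (Rmin (eta / 8) (eta / (8 * c2))) (lam / (16 * c1))).
  pose proof (Rmin_r (Rmin (eta / 8) (eta / (8 * c2))) (lam / (16 * c1))).
  pose proof (Rmin_l (eta / 8) (eta / (8 * c2))). pose proof (Rmin_r (eta / 8) (eta / (8 * c2))).
  assert (Rrho : rd <= rho) by lra. assert (Rdf : rd <= df) by lra.
  assert (RT : rd <= T - tb) by lra. assert (Rone : rd <= 1) by lra.
  assert (Reta : rd <= eta / 8) by lra.
  assert (Reta2 : rd * c2 <= eta / 8).
  { replace (eta / 8) with (eta / (8 * c2) * c2) by (field; lra).
    apply Rmult_le_compat_r; lra. }
  assert (Rlam : rd * c1 <= lam / 16).
  { replace (lam / 16) with (lam / (16 * c1) * c1) by (field; lra).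
    apply Rmult_le_compat_r; lra. }
  clear R1 R2 H H0 H1 H2 H3 H4 H5 H6 H7 H8. clearbody rd.
  destruct (doubling_localized 0 T (xb - 1) (xb + 1) th ut w tb xb (rd / 2) Hut Hw)
    as (n & s0 & y0 & s1 & y1 & Hn & HD0 & HD1 & Hdbl & D1 & D2 & D3 & D4 & D5 & D6 & D7 & D8).
  { unfold rect; lra. }
  { lra. }
  { intros s y [Hs Hy]. specialize (Hmax s y Hs). unfold ut, w. rewrite !Rminus_diag. lra. }
  { lra. }
  (* This dominates the coefficients of [r] in [E1], [E2] and [E4]. Since it contains [n], the scale
     [r] is chosen after the doubling, whereas [rd] is chosen before it. *)
  set (c3 := n * (60 + 864 * L ^ 2 + 60 * Lb + 24 * L) + Lb ^ 2 + 1).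
  assert (Hc3 : 0 < c3).
  { assert (0 <= n * (60 + 864 * L ^ 2 + 60 * Lb + 24 * L)) by (apply Rmult_le_pos; lra).
    pose proof (pow2_ge_0 Lb). unfold c3. lra. }
  set (r := Rmin (Rmin (rd / 12) (lam / (16 * c3))) (eta / (8 * (360 * n)))).
  assert (Hr : 0 < r).
  { repeat apply Rmin_glb_lt; [lra| |]; apply Rdiv_lt_0_compat; lra. }
  assert (Q1 : r <= Rmin (rd / 12) (lam / (16 * c3))) by apply Rmin_l.
  assert (Q2 : r <= eta / (8 * (360 * n))) by apply Rmin_r.
  pose proof (Rmin_l (rd / 12) (lam / (16 * c3))) as Q3.
  pose proof (Rmin_r (rd / 12) (lam / (16 * c3))) as Q4.
  assert (Rr : r <= rd / 12) by lra.
  assert (Rc3 : r * c3 <= lam / 16).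
  { replace (lam / 16) with (lam / (16 * c3) * c3) by (field; lra).
    apply Rmult_le_compat_r; lra. }
  assert (Rn : 360 * n * r <= eta / 8).
  { replace (eta / 8) with (360 * n * (eta / (8 * (360 * n)))) by (field; lra).
    apply Rmult_le_compat_l; lra. }
  clear Q1 Q2 Q3 Q4. clearbody r.
  destruct (theorem_on_sums 0 T (xb - 1) (xb + 1) n ut w s0 y0 s1 y1 r Hut Hw Hn HD0 HD1 Hdbl)
    as (A & A' & s & y & q & p & s' & y' & q' & p' &
        (J1 & J2 & J3 & J4 & J5 & J6 & J7) & (K1 & K2 & K3 & K4 & K5 & _ & K7) & Hmat);
    try lra.
  assert (Hclose : forall z z0 zb, Rabs (z0 - zb) < rd / 2 -> Rabs (z - z0) <= 6 * r ->
    Rabs (z - zb) < rd).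
  { intros z z0 zb H1 H2. replace (z - zb) with ((z - z0) + (z0 - zb)) by ring.
    eapply Rle_lt_trans; [apply Rabs_triang|lra]. }
  assert (Cs := Hclose _ _ _ D1 J2). assert (Cy := Hclose _ _ _ D2 J3).
  assert (Cs' := Hclose _ _ _ D3 K2). assert (Cy' := Hclose _ _ _ D4 K3).
  destruct J1 as [Hs Hyr]. destruct K1 as [Hs' Hyr'].
  assert (Cyb := Rabs_def2 _ _ Cy). assert (Cyb' := Rabs_def2 _ _ Cy').
  assert (Csb := Rabs_def2 _ _ Cs). assert (Csb' := Rabs_def2 _ _ Cs').
  (* U at the jet point is close to U(tb, xb), so no impulse is optimal there *)
  assert (HUs : U tb xb - eta < U s y).
  { assert (th * (xb ^ 2 - y ^ 2) <= eta / 8).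
    { eapply Rle_trans; [|exact Reta2].
      replace (th * (xb ^ 2 - y ^ 2)) with (th * ((xb - y) * (xb + y))) by ring.
      apply Rle_trans with (th * (rd * (2 * Rabs xb + 1))).
      - apply Rmult_le_compat_l; [lra|]. eapply Rle_trans; [apply Rle_abs|].
        rewrite Rabs_mult, Rabs_minus_sym. apply Rmult_le_compat; auto using Rabs_pos; [lra|].
        replace (xb + y) with (2 * xb + (y - xb)) by ring.
        eapply Rle_trans; [apply Rabs_triang|]. rewrite Rabs_mult, (Rabs_pos_eq 2); lra.
      - unfold c2. nra. }
    assert (0 <= th * ((s - tb) ^ 2 + (y - xb) ^ 2)).
    { apply Rmult_le_pos; [lra|]. pose proof (pow2_ge_0 (s - tb)).
      pose proof (pow2_ge_0 (y - xb)). lra. }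
    assert (ut tb xb = U tb xb - th * xb ^ 2) by (unfold ut; rewrite !Rminus_diag; ring).
    unfold ut in *. lra. }
  assert (HUM := Hnoimp s y Hs ltac:(lra) ltac:(lra) HUs).
  set (qU := q + 2 * th * (s - tb)).
  set (pU := p + (2 * th * y + 2 * th * (y - xb))).
  assert (JU : quad_above (strip T) U s y qU pU (A + 4 * th)).
  { apply (quad_above_strip T U (xb - 1) (xb + 1)); [lra|].
    destruct J7 as [n0 [d [Hd0 H]]]. exists (n0 + th), d. split; auto.
    intros s2 y2 HD2 H1 H2. specialize (H s2 y2 HD2 H1 H2). unfold ut in H.
    unfold qU, pU.
    replace (U s2 y2) with ((U s2 y2 - th * y2 ^ 2 - th * ((s2 - tb) ^ 2 + (y2 - xb) ^ 2)) +
      (th * y2 ^ 2 + th * ((s2 - tb) ^ 2 + (y2 - xb) ^ 2))) by ring.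
    eapply Rle_trans; [apply Rplus_le_compat_r, H|]. right. field. }
  destruct (visc_sub_quad dW T a b f g Z Gam K U L M s y qU pU (A + 4 * th)
    Hi HW Hd Hf HB Hg Hs HU JU) as [H|[HUeq|[H _]]]; [lra| |lra].
  (* One control, nearly optimal for [U], is inserted in both inequalities; for [V] any control
     gives a valid bound. *)
  destruct (Ham_approx T a b f L M s y pU (A + 4 * th) (lam / 16) Hi HB Hs) as [w0 Hw0]; [lra|].
  set (qV := - ((q' - lam * (M + 1)) / (1 - lam))).
  set (pV := - (p' / (1 - lam))). set (AV := - (A' / (1 - lam))).
  assert (JV : quad_above (strip T) (fun s y => - V s y) s' y' (- qV) (- pV) (- AV)).
  { apply (quad_above_strip T _ (xb - 1) (xb + 1)); [lra|].
    destruct K7 as [n0 [d [Hd0 H]]]. exists (n0 / (1 - lam)), d. split; auto.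
    intros s2 y2 HD2 H1 H2. specialize (H s2 y2 HD2 H1 H2). unfold w, v in H.
    unfold qV, pV, AV. apply Rmult_le_reg_l with (1 - lam); [lra|].
    match goal with |- _ <= ?rhs => replace rhs with
      ((1 - lam) * - V s' y' + (q' - lam * (M + 1)) * (s2 - s') + n0 * (s2 - s') ^ 2 +
       p' * (y2 - y') + A' / 2 * (y2 - y') ^ 2) by (field; lra) end.
    lra. }
  destruct (visc_super_quad dW T a b f g Z Gam K V L M s' y' qV pV AV
    Hi HW Hd Hf HB Hg Hs' HV JV) as [_ [HVeq|[H _]]]; [|lra].
  assert (Hw0' := Ham_ub T a b f L M s' y' pV AV w0 HB Hs').
  (* Multiplying by [1 - lam] returns to the jet of [w = - v]; the term [lam * (M + 1)] is the
     strict gain. *)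
  assert (HVeq2 : (1 - lam) * f s' y' w0 <=
    q' - lam * (M + 1) + (/ 2 * (b y' w0) ^ 2 * A' + a y' w0 * p')).
  { assert (H : (1 - lam) * (qV + (/ 2 * b y' w0 ^ 2 * AV + a y' w0 * pV + f s' y' w0)) <=
      (1 - lam) * 0) by (apply Rmult_le_compat_l; lra).
    replace ((1 - lam) * (qV + (/ 2 * b y' w0 ^ 2 * AV + a y' w0 * pV + f s' y' w0))) with
      (- (q' - lam * (M + 1)) - / 2 * b y' w0 ^ 2 * A' - a y' w0 * p' + (1 - lam) * f s' y' w0)
      in H by (unfold qV, pV, AV; field; lra).
    lra. }
  assert (F1 := Hfu s y Hs ltac:(lra) ltac:(lra) w0). apply Rabs_def2 in F1.
  assert (F2 := Hfu s' y' Hs' ltac:(lra) ltac:(lra) w0). apply Rabs_def2 in F2.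
  assert (F3 := cb_f _ _ _ _ _ _ HB s' y' w0 Hs'). apply Rabs_le_bounds in F3.
  assert (F4 : lam * f s' y' w0 <= lam * M) by (apply Rmult_le_compat_l; lra).
  assert (Hya : forall z, Rabs (z - xb) < rd -> L * (1 + Rabs z) <= Lb).
  { intros z Hz. apply Rmult_le_compat_l; auto.
    assert (Rabs z <= Rabs xb + 1); [|lra].
    replace z with ((z - xb) + xb) by ring. eapply Rle_trans; [apply Rabs_triang|lra]. }
  assert (E1 := diffusion_estimate L Lb n r (rd / 2) A A' (b y w0) (b y' w0) y y' y0 y1 HL Hn
    ltac:(lra) (cb_blip _ _ _ _ _ _ HB y y' w0)
    (Rle_trans _ _ _ (cb_b _ _ _ _ _ _ HB y w0) (Hya y Cy))
    (Rle_trans _ _ _ (cb_b _ _ _ _ _ _ HB y' w0) (Hya y' Cy')) Hmat D7 J3 K3).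
  assert (E2 := drift_estimate L Lb n r (rd / 2) (a y w0) (a y' w0) p p' y y' y0 y1 HL Hn
    ltac:(lra) (cb_alip _ _ _ _ _ _ HB y y' w0)
    (Rle_trans _ _ _ (cb_a _ _ _ _ _ _ HB y w0) (Hya y Cy))
    (Rle_trans _ _ _ (cb_a _ _ _ _ _ _ HB y' w0) (Hya y' Cy')) J5 K5 D7 D6 J3 K3).
  assert (E3 := penalty_estimate L th ka (a y w0) (b y w0) y xb HL Hth Hthx ltac:(lra)
    (cb_a _ _ _ _ _ _ HB y w0) (cb_b _ _ _ _ _ _ HB y w0)).
  assert (E4 : q + q' <= 60 * n * r).
  { apply Rabs_le_bounds in J4. apply Rabs_le_bounds in K4. lra. }
  assert (E5 : 2 * th * (s - tb) <= 2 * ka).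
  { assert (th * (s - tb) <= th * 1) by (apply Rmult_le_compat_l; lra). lra. }
  unfold qU, pU in *. unfold c1 in Rlam. unfold c3 in Rc3.
  (* After [lam * M] absorbs [lam * f], the gain left is [lam]. The errors are [lam / 4] for the
     penalties, [lam / 8] for [f], and [lam / 16] each for the control, [rd] and [r]: in total
     [9 * lam / 16]. *)
  clear - HVeq2 F1 F2 F4 E1 E2 E3 E4 E5 HUeq Hw0 Rlam Rc3 Hka Hlam Hrd Hr.
  lra.
Qed.

Theorem theorem4p10
  (T : R) (HT : 0 < T)
  (W : Type) (dW : W -> W -> R) (HdW : is_metric dW)
  (HWne : inhabited W) (HWc : compact_set dW (fun _ => True))
  (Y : Type) (dY : Y -> Y -> R) (HdY : is_metric dY)
  (Z : R -> R -> Y -> Prop)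
  (HZne : forall t x, 0 <= t <= T -> exists z, Z t x z)
  (HZc : forall t x, 0 <= t <= T -> compact_set dY (Z t x))
  (HZcont : hausdorff_continuous dY T Z)
  (a b : R -> W -> R) (f : R -> R -> W -> R) (g : R -> R)
  (Gam K : R -> R -> Y -> R)
  (Ha : cont_RX dW a) (Hb : cont_RX dW b) (Hf : cont_TRX dW T f)
  (Hg : continuity g)
  (HGam : cont_TRX dY T Gam) (HK : cont_TRX dY T K)
  (Hfb : exists M, forall t x w, 0 <= t <= T -> Rabs (f t x w) <= M)
  (Hgb : exists M, forall x, Rabs (g x) <= M)
  (HKneg : exists c, c < 0 /\ forall t x z, 0 <= t <= T -> Z t x z -> K t x z <= c)
  (Hlip : exists C, forall x y w,
      Rabs (a x w - a y w) + Rabs (b x w - b y w) <= C * Rabs (x - y))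
  (HMg : forall x, Mg T Z Gam K g x <= g x)
  (U V : R -> R -> R)
  (HUb : bounded_on T U) (HVb : bounded_on T V)
  (HU : visc_sub T a b f g Z Gam K U)
  (HV : visc_super T a b f g Z Gam K V) :
  forall t x, 0 <= t <= T -> U t x <= V t x.
Proof.
  intros t1 x1 Ht1. apply Rnot_lt_le; intro Hlt.
  destruct (coef_bounds_exist dW T a b f HWne HWc HdW Ha Hb Hfb Hlip) as (L & M & HB).
  pose proof (cb_L _ _ _ _ _ _ HB) as HL. pose proof (cb_M _ _ _ _ _ _ HB) as HM.
  destruct Hgb as [G HG]. destruct HKneg as [c [Hc HKc]].
  destruct HUb as [BU HBU]. destruct HVb as [BV HBV].
  assert (HI : impulse_data T dY Z Gam K c) by (split; auto).
  assert (HG0 : 0 <= G) by (pose proof (Rabs_pos (g 0)); specialize (HG 0); lra).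
  assert (HBU0 : 0 <= BU) by (pose proof (Rabs_pos (U t1 x1)); specialize (HBU t1 x1 Ht1); lra).
  assert (HBV0 : 0 <= BV) by (pose proof (Rabs_pos (V t1 x1)); specialize (HBV t1 x1 Ht1); lra).
  assert (HGg : forall y, g y <= G).
  { intro y. eapply Rle_trans; [apply Rle_abs|auto]. }
  assert (HUub : forall s y, 0 <= s <= T -> U s y <= BU).
  { intros s y Hs. eapply Rle_trans; [apply Rle_abs|auto]. }
  assert (HVub : forall s y, 0 <= s <= T -> V s y <= BV).
  { intros s y Hs. eapply Rle_trans; [apply Rle_abs|auto]. }
  assert (HUT : forall y, U T y <= g y).
  { intro y. apply (sub_terminal dW T a b f g dY Z Gam K U L M BU G c); auto. }
  assert (HVT : forall y, g y <= V T y).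
  { intro y. apply (super_terminal dW T a b f g Z Gam K V L M BV); auto. }
  assert (HVM : forall s y, 0 <= s <= T -> Mop Z Gam K V s y <= V s y).
  { intros s y Hs.
    apply (super_obstacle dW T a b f g dY Z Gam K V L M BV c); auto. }
  set (e1 := U t1 x1 - V t1 x1).
  set (BB := G + (M + 1) * T).
  assert (HBB : 0 <= BB) by (unfold BB; assert (0 <= (M + 1) * T) by (apply Rmult_le_pos; lra); lra).
  (* At [(t1, x1)] replacing [V] by [v] costs at most [e1 / 2], so [U - v] stays positive there. *)
  set (lam := Rmin (1 / 2) (e1 / (2 * (BV + BB + 1)))).
  assert (He1 : 0 < e1) by (unfold e1; lra).
  assert (Hlam : 0 < lam) by (apply Rmin_glb_lt; [lra|apply Rdiv_lt_0_compat; lra]).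
  assert (Hlam1 : lam <= 1 / 2) by apply Rmin_l.
  assert (Hlam2 : lam * (BV + BB + 1) <= e1 / 2).
  { replace (e1 / 2) with (e1 / (2 * (BV + BB + 1)) * (BV + BB + 1)) by (field; lra).
    apply Rmult_le_compat_r; [lra|apply Rmin_r]. }
  clearbody lam.
  set (Bf := fun s => G + (M + 1) * (T - s)).
  assert (HBf : forall s, 0 <= s <= T -> 0 <= Bf s <= BB).
  { intros s Hs. unfold Bf, BB. split.
    - assert (0 <= (M + 1) * (T - s)) by (apply Rmult_le_pos; lra). lra.
    - assert ((M + 1) * (T - s) <= (M + 1) * T) by (apply Rmult_le_compat_l; lra). lra. }
  set (v := fun s y => (1 - lam) * V s y + lam * Bf s).
  assert (Hvb : forall s y, 0 <= s <= T -> Rabs (v s y) <= BV + BB).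
  { intros s y Hs. specialize (HBf s Hs). specialize (HBV s y Hs).
    apply Rabs_le_bounds in HBV. apply Rabs_le. unfold v.
    assert ((1 - lam) * V s y <= (1 - lam) * BV) by (apply Rmult_le_compat_l; lra).
    assert ((1 - lam) * - BV <= (1 - lam) * V s y) by (apply Rmult_le_compat_l; lra).
    assert (0 <= lam * Bf s) by (apply Rmult_le_pos; lra).
    assert (lam * Bf s <= 1 * BB) by (apply Rmult_le_compat; lra).
    assert (0 <= lam * BV) by (apply Rmult_le_pos; lra). lra. }
  set (Bd := BU + (BV + BB)).
  assert (Hd : forall s y, 0 <= s <= T -> Rabs (U s y - v s y) <= Bd).
  { intros s y Hs. specialize (HBU s y Hs). specialize (Hvb s y Hs).
    unfold Rminus. eapply Rle_trans; [apply Rabs_triang|]. rewrite Rabs_Ropp. unfold Bd. lra. }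
  set (E := fun k => exists s y, 0 <= s <= T /\ k = U s y - v s y).
  assert (HEne : exists k, E k) by (exists (U t1 x1 - v t1 x1), t1, x1; auto).
  assert (HEb : forall k, E k -> k <= Bd).
  { intros k (s & y & Hs & ->). eapply Rle_trans; [apply Rle_abs|auto]. }
  set (S := Rsup E).
  assert (HS : forall s y, 0 <= s <= T -> U s y - v s y <= S).
  { intros s y Hs. apply (Rsup_ub E Bd); auto. now exists s, y. }
  assert (HS0 : 0 < S).
  { apply Rlt_le_trans with (U t1 x1 - v t1 x1); [|now apply HS].
    specialize (HBf t1 Ht1). specialize (HBV t1 x1 Ht1). apply Rabs_le_bounds in HBV.
    assert (lam * (Bf t1 - V t1 x1) <= lam * (BV + BB + 1)) by (apply Rmult_le_compat_l; lra).
    unfold v, e1 in *. lra. }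
  (* The share [1 - lam] of [K] is absorbed by the obstacle inequality of [V]; the share [lam] is
     left as the gap, because [Bf] is unaffected by a jump in space. *)
  assert (HMU : forall s y, 0 <= s <= T -> Mop Z Gam K U s y <= S + v s y + lam * c).
  { intros s y Hs. apply (Mop_le Z Gam K T dY c); auto. intros z Hz.
    assert (H1 := HS s (Gam s y z) Hs).
    assert (H2 := Mop_ge Z Gam K T dY c BV s y V z HI Hs HVub Hz).
    specialize (HVM s y Hs). specialize (HKc s y z Hs Hz).
    assert (H3 : (1 - lam) * (V s (Gam s y z) + K s y z) <= (1 - lam) * V s y)
      by (apply Rmult_le_compat_l; lra).
    assert (H4 : lam * K s y z <= lam * c) by (apply Rmult_le_compat_l; lra).
    unfold v in *. lra. }
  set (kb := 2 + 28 * L ^ 2 + 28 * L).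
  assert (Hkb : 0 < kb) by (pose proof (pow2_ge_0 L); unfold kb; lra).
  (* The three bounds keep the maximum positive (hence off time [T]), preserve the obstacle gap, and
     make the penalty error at most [lam / 4]. *)
  set (ka := Rmin (Rmin (S / 4) (- (lam * c) / 4)) (lam / 4 / kb)).
  assert (Hlc : 0 < - (lam * c)) by (assert (0 < lam * - c) by (apply Rmult_lt_0_compat; lra); lra).
  assert (Hka : 0 < ka) by (repeat apply Rmin_glb_lt; try lra; apply Rdiv_lt_0_compat; lra).
  assert (Hka1 : ka <= S / 4) by (eapply Rle_trans; [apply Rmin_l|apply Rmin_l]).
  assert (Hka2 : ka <= - (lam * c) / 4) by (eapply Rle_trans; [apply Rmin_l|apply Rmin_r]).
  assert (Hka3 : ka * kb <= lam / 4).
  { replace (lam / 4) with (lam / 4 / kb * kb) by (field; lra).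
    apply Rmult_le_compat_r; [lra|apply Rmin_r]. }
  clearbody ka.
  destruct (Rsup_approx E Bd ka HEne HEb Hka) as [k [(s2 & x2 & Hs2 & ->) Hk]]. fold S in Hk.
  (* Chosen after the near-maximizer [x2], so the penalty there is at most [ka]. The penalized
     maximum is then at least [S - 2 * ka], whence [th * xb ^ 2 <= 2 * ka]. *)
  set (th := ka / (1 + x2 ^ 2)).
  pose proof (pow2_ge_0 x2) as Hx2.
  assert (Hth : 0 < th) by (apply Rdiv_lt_0_compat; lra).
  assert (Hthk : th * (1 + x2 ^ 2) = ka) by (unfold th; field; lra).
  assert (Hthx2 : 0 <= th * x2 ^ 2) by (apply Rmult_le_pos; lra).
  assert (Hth1 : th <= ka) by lra.
  clearbody th.
  set (d := (2 * Bd + 1) / th + 1).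
  assert (HBd : 0 <= Bd) by (unfold Bd; lra).
  assert (Hd0 : 0 < (2 * Bd + 1) / th) by (apply Rdiv_lt_0_compat; lra).
  assert (Hthd : 2 * Bd < th * d ^ 2).
  { assert (th * d = 2 * Bd + 1 + th) by (unfold d; field; lra).
    assert (1 <= d) by (unfold d; lra). nra. }
  (* [(T, 0)] is only a reference point and time is not penalized; beyond distance [d] the space
     penalty exceeds [2 * Bd], so the maximum is global. *)
  destruct (penalized_max T (fun s y => U s y - v s y) Bd T 0 th d (fun _ => 0))
    as (tb & xb & Htb & Hxb & _ & Hle & Hmaxl); auto; try lra.
  { apply (usc_on_ext T (fun s y => U s y + ((1 - lam) * (- V s y) + ((- lam) * Bf s + 0)))).
    - intros; unfold v; ring.
    - apply usc_on_plus; [apply HU|].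
      apply usc_on_plus; [apply usc_on_scale; [lra|apply lsc_on_opp, HV]|].
      apply (usc_on_separable T (fun s => (- lam) * Bf s) (fun _ => 0)); unfold Bf; reg. }
  { reg. }
  { intros; lra. }
  { unfold d; lra. }
  assert (Hmax : forall s y, 0 <= s <= T ->
     U s y - v s y - th * y ^ 2 <= U tb xb - v tb xb - th * xb ^ 2).
  { intros s y Hs. destruct (Rlt_dec (Rabs (y - 0)) d) as [Hy|Hy].
    - specialize (Hmaxl s y Hs Hy). rewrite !Rminus_0_r in Hmaxl. lra.
    - assert (H1 := Hmaxl T 0 ltac:(lra)).
      rewrite Rminus_diag, Rabs_R0, !Rminus_0_r in H1.
      specialize (H1 ltac:(unfold d; lra)).
      assert (H2 := Hd s y Hs). apply Rabs_le_bounds in H2.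
      assert (H3 := Hd T 0 ltac:(lra)). apply Rabs_le_bounds in H3.
      assert (d ^ 2 <= y ^ 2).
      { rewrite <- (pow2_abs y). apply pow_incr. rewrite Rminus_0_r in Hy. unfold d in *; lra. }
      assert (th * d ^ 2 <= th * y ^ 2) by (apply Rmult_le_compat_l; lra).
      lra. }
  assert (Hval := Hmax s2 x2 Hs2). assert (HSb := HS tb xb Htb).
  assert (Hxb2 : 0 <= th * xb ^ 2) by (apply Rmult_le_pos; [lra|apply pow2_ge_0]).
  assert (HtbT : tb < T).
  { destruct (Req_dec tb T) as [->|Hne]; [|lra]. exfalso.
    specialize (HUT xb). specialize (HVT xb). specialize (HGg xb).
    assert ((1 - lam) * g xb <= (1 - lam) * V T xb) by (apply Rmult_le_compat_l; lra).
    assert (lam * g xb <= lam * G) by (apply Rmult_le_compat_l; lra).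
    assert (v T xb = (1 - lam) * V T xb + lam * G) by (unfold v, Bf; ring). lra. }
  specialize (HMU tb xb Htb).
  (* [U] is only upper semicontinuous, so [Mop Z Gam K U < U] need not hold on a neighbourhood. It
     does at nearby points where [U] exceeds [U tb xb - eta], and the doubled points are of this
     kind. *)
  set (eta := (U tb xb - Mop Z Gam K U tb xb) / 2).
  assert (Heta : 0 < eta) by (unfold eta; lra).
  destruct (Mop_usc Z Gam K T dY c BU U HI HUub (proj1 HU) tb xb Htb eta Heta)
    as [rho [Hrho Husc]].
  apply (no_positive_maximum dW T a b f g Z Gam K U V L M lam G ka th tb xb eta rho);
    auto; try lra.
  intros s y Hs H1 H2 H3. specialize (Husc s y Hs H1 H2). unfold eta in *. lra.
Qed.
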